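(* Let $G$ be the $n\times n$ grid, $\Omega$ its set of independent sets with $\pi(I)=\lambda^{|I|}/Z$, $Z=\sum_{I\in\Omega}\lambda^{|I|}$, and let $\Omega_{\mathcal F}$ be the set of independent sets on $G$ with a fault line. If $\lambda$ satisfies $1+\lambda>\mu_t^4$ and $2(1+\lambda)>\mu_t^2(1+\sqrt{1+4\lambda})$, then $\pi(\Omega_{\mathcal F})\le p(n)e^{-c'n}$ for some polynomial $p(n)$ and constant $c'>0$.
   Context: The $n\times n$ grid is the subgraph of $\mathbb{Z}^2$ induced by $\{0,\dots,n-1\}^2$; vertices are even/odd by parity of coordinate sum. $G_\Diamond$ is the graph whose vertices are midpoints of edges of $G$, adjacent iff midpoints of incident perpendicular edges. Given an independent set $I$, a spanning path is a simple path in $G_\Diamond$ from the top boundary to the bottom boundary or from the left boundary to the right boundary, each vertex of which is the midpoint of an edge of $G$ with both endpoints unoccupied in $I$; color each vertex $v$ of the path blue if the odd endpoint of the edge bisected by $v$ lies to the left of the path as it passes $v$, red otherwise; an alternation point is a place where the color changes. A fault line is a spanning path with zero or one alternation points. The Manhattan lattice $\vec{\mathbb{Z}}^2$ orients edges of $\mathbb{Z}^2$ parallel to the $x$-axis positively iff their $y$-coordinate is even, and edges parallel to the $y$-axis positively iff their $x$-coordinate is even. A taxi walk of length $m$ is an $m$-step oriented walk in $\vec{\mathbb{Z}}^2$ from the origin, never revisiting a vertex, never taking two left or two right turns in a row; with $c_m$ their number, $\mu_t=\lim_{m\to\infty}c_m^{1/m}$ is the taxi walk connective constant. *)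

(* Defs.v *)
From HB Require Import structures.
From mathcomp Require Import all_boot all_order all_algebra.
From mathcomp Require Import all_classical all_reals all_analysis.

Set Implicit Arguments.
Unset Strict Implicit.
Unset Printing Implicit Defensive.

Import Order.TTheory GRing.Theory Num.Theory.
Import numFieldNormedType.Exports.

Local Open Scope ring_scope.

Notation point := (int * int)%type.

Definition z2_adj (u v : point) : bool :=
  `|u.1 - v.1| + `|u.2 - v.2| == 1.

Definition cross (a b : point) : int := a.1 * b.2 - a.2 * b.1.

Definition dot (a b : point) : int := a.1 * b.1 + a.2 * b.2.

Definition steps (w : seq point) : seq point :=
  if w is x :: w' then pairmap (fun a b => b - a) x w' else [::].

Notation vertex n := ('I_n * 'I_n)%type.

Definition pos n (u : vertex n) : point := ((u.1 : nat)%:Z, (u.2 : nat)%:Z).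

Definition grid_adj n (u v : vertex n) : bool := z2_adj (pos u) (pos v).

Definition odd_vertex n (u : vertex n) : bool := odd (u.1 + u.2).

Definition independent n (I : {set vertex n}) : bool :=
  [forall u in I, forall v in I, ~~ grid_adj u v].

Definition partition_function (R : realType) n (lambda : R) : R :=
  \sum_(I : {set vertex n} | independent I) lambda ^+ #|I|.

Definition gibbs (R : realType) n (lambda : R) (I : {set vertex n}) : R :=
  lambda ^+ #|I| / partition_function n lambda.

Definition gibbs_event (R : realType) n (lambda : R)
    (A : {set {set vertex n}}) : R :=
  \sum_(I in A) gibbs lambda I.

(** A midpoint is represented in doubled coordinates, i.e. by the sum of the
    two endpoints of its edge.  This determines the edge. *)
Definition bisects n (m : point) (u v : vertex n) : bool :=
  grid_adj u v && (m == pos u + pos v).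

Definition diamond_adj n (m1 m2 : point) : bool :=
  [exists u : vertex n, exists v : vertex n, exists w : vertex n,
    [&& bisects m1 u v, bisects m2 u w & dot (pos v - pos u) (pos w - pos u) == 0]].

Definition unoccupied_edge n (I : {set vertex n}) (m : point) : bool :=
  [exists u : vertex n, exists v : vertex n,
    [&& bisects m u v, u \notin I & v \notin I]].

(** The doubled coordinate of the top and right sides is [2 (n - 1)]. *)
Definition top_to_bottom n (a b : point) : bool :=
  (a.2 == (n%:Z - 1) *+ 2) && (b.2 == 0).

Definition left_to_right n (a b : point) : bool :=
  (a.1 == 0) && (b.1 == (n%:Z - 1) *+ 2).

Definition spanning_path n (I : {set vertex n}) (p : seq point) : bool :=
  if p is x :: s then
    [&& path (@diamond_adj n) x s, uniq p, all (unoccupied_edge I) p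
      & top_to_bottom n x (last x s) || left_to_right n x (last x s)]
  else false.

(** Whether [w] points into the sector on the left of a path that arrives in
    direction [d1] and leaves in direction [d2]: this sector is convex when the
    path turns left, and the complement of a convex one when it turns right. *)
Definition on_left (d1 d2 w : point) : bool :=
  if 0 <= cross d1 d2 then (0 < cross d1 w) && (0 < cross d2 w)
  else (0 < cross d1 w) || (0 < cross d2 w).

(** Colour of the [i]-th vertex of [p] ([true] is blue).  At its two ends the
    path is regarded as continuing straight. *)
Definition blue n (p : seq point) (i : nat) : bool :=
  let d := steps p in
  let din := nth 0 d i.-1 in
  let dout := nth 0 d (minn i (size d).-1) in
  [exists u : vertex n, exists v : vertex n,
    [&& bisects (nth 0 p i) u v, odd_vertex u & on_left din dout (pos u - pos v)]].

Definition alternations n (p : seq point) : nat :=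
  count (fun i => blue n p i != blue n p i.+1) (iota 0 (size p).-1).

Definition fault_line n (I : {set vertex n}) (p : seq point) : bool :=
  spanning_path I p && (alternations n p <= 1)%N.

Definition fault_sets n : {set {set vertex n}} :=
  [set I | independent I && `[< exists p, fault_line I p >]].

Definition orientation (z : int) : int := if odd `|z|%N then -1 else 1.

Definition manhattan_arc (u v : point) : bool :=
  (v == u + (orientation u.2, 0)) || (v == u + (0, orientation u.1)).

Definition turns (w : seq point) : seq int :=
  if steps w is d :: s then pairmap cross d s else [::].

Definition no_repeated_turn (w : seq point) : bool :=
  sorted (fun a b : int => ~~ ((0 < a) && (0 < b)) && ~~ ((a < 0) && (b < 0)))
         (turns w).

Definition taxi_walk (w : seq point) : bool :=
  if w is x :: s then
    [&& x == 0, path manhattan_arc x s, uniq w & no_repeated_turn w]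
  else false.

(** Walks are counted through their sequences of unit steps, a step being
    coded by [(is it vertical?, is it positive?)]. *)
Definition unit_step (d : bool * bool) : point :=
  let s : int := if d.2 then 1 else -1 in if d.1 then (0, s) else (s, 0).

Definition trajectory (s : seq (bool * bool)) : seq point :=
  0 :: scanl (fun x d => x + unit_step d) 0 s.

Definition taxi_count (m : nat) : nat :=
  #|[set s : m.-tuple (bool * bool) | taxi_walk (trajectory s)]|.

Definition mu_t (R : realType) : R :=
  limn (fun m : nat => ((taxi_count m)%:R : R) `^ (m%:R^-1)).

(* Main.v *)
(**
A path in the diamond graph either crosses the edge it bisects or merely touches it,
turning inside a face.  The colour is constant between touches and changes at an
isolated touch, while two consecutive touches can be short-cut.  So a set with a
fault line has a simple path, crossing the grid from side to side, with at most one
touch.  A shortest such path never makes two equal turns in a row on either side of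
the touch, because it would encircle a vertex and could be short-cut.  Rotated by
45 degrees, the two pieces are therefore taxi walks, and the number of paths of
length l is at most poly(n) (mu_t + epsilon)^l.

Every face has an even number of crossed sides, so the crossed edges are the
boundary of a set of vertices h = 1; no Jordan curve theorem is needed.  All
endpoints of crossed edges are unoccupied.  Moving the occupied vertices with h = 1 one
step across the grid keeps the set independent and frees l/4 + n/2 - O(1) pairwise
non-adjacent vertices that may be occupied or not at will.  Only the occupied
vertices of the last column are lost, and independent sets of a path with n vertices
have weight O(r^n) with r = (1 + sqrt(1 + 4 lambda)) / 2.  Hence the weight of the
sets with a given path is at most Z O(r^n) (1 + lambda)^-(l/4 + n/2).  As l is at
least 2n - 1, summation over l gives an exponentially small bound under the two
hypotheses.
*)
Require Import Defs.
From HB Require Import structures.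
From mathcomp Require Import all_boot all_order all_algebra.
From mathcomp Require Import all_classical all_reals all_analysis.
From mathcomp Require Import zify ring lra.

Set Implicit Arguments.
Unset Strict Implicit.
Unset Printing Implicit Defensive.

Import Order.TTheory GRing.Theory Num.Theory.
Import numFieldNormedType.Exports.

Local Open Scope ring_scope.

Local Notation Z2 := (int * int)%type.

(** * Local geometry of midpoint paths *)

(* Whether the edge bisected by [m] is horizontal; recall that midpoints are in
   doubled coordinates. *)
Definition horizontal (m : Z2) : bool := odd `|m.1|%N.

Definition is_midpoint (m : Z2) : bool := odd `|(m.1 + m.2)%R|%N.

(* Whether the odd endpoint of the bisected edge is its right or upper one. *)
Definition sigma (m : Z2) : bool := ((m.1 + m.2) %% 4)%Z == 1.

(** In doubled coordinates the midpoints of two incident perpendicular edges differ by one in both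
    coordinates. *)
Definition diag (a b : Z2) : bool :=
  (`|b.1 - a.1| == 1) && (`|b.2 - a.2| == 1).

(* The colour of [a] when the path crosses straight from [a] towards [b]; it is
   then also the colour of [b].  Along a path [a, b, c] the edge at [b] is crossed
   if [eta a b = eta b c]; otherwise the path only touches [b], and [a, b, c] are
   three sides of one face. *)
Definition eta (a b : Z2) : bool :=
  sigma a == (if horizontal a then b.2 < a.2 else a.1 < b.1).

Definition in_box (N : int) (m : Z2) : bool :=
  [&& is_midpoint m, 0 <= m.1 <= N & 0 <= m.2 <= N].

Definition shift4 (v m : Z2) : Z2 := (m.1 + 4 * v.1, m.2 + 4 * v.2).

Lemma horizontal_shift4 v m : horizontal (shift4 v m) = horizontal m.
Proof. by rewrite /horizontal /=; lia. Qed.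

Lemma sigma_shift4 v m : sigma (shift4 v m) = sigma m.
Proof. by rewrite /sigma /=; lia. Qed.

Lemma diag_shift4 v a b : diag (shift4 v a) (shift4 v b) = diag a b.
Proof. by rewrite /diag /=; lia. Qed.

Lemma eta_shift4 v a b : eta (shift4 v a) (shift4 v b) = eta a b.
Proof. by rewrite /eta horizontal_shift4 sigma_shift4 /= !ltrD2r. Qed.

Lemma eq_shift4 v a b : (shift4 v a == shift4 v b) = (a == b).
Proof.
by case: a b => [x y] [z w]; rewrite /shift4 !xpair_eqE /= !(inj_eq (addIr _)).
Qed.

Lemma sub_shift4 v a b : shift4 v a - shift4 v b = a - b.
Proof. by congr pair => /=; ring. Qed.

Definition diag_vec (d : bool * bool) : Z2 :=
  (if d.1 then 1 else -1, if d.2 then 1 else -1).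

Lemma diagE v a b : diag (shift4 v a) b -> exists d, b = shift4 v (a + diag_vec d).
Proof.
case: a b => [x y] [z w] /andP[/= hx hy].
exists (x + 4 * v.1 < z, y + 4 * v.2 < w); rewrite /shift4 /=.
by congr pair; case: ifP; lia.
Qed.

(** The residues modulo 4 of the points of odd coordinate sum. *)
Definition base_points : seq Z2 :=
  [:: (0, 1); (0, 3); (1, 0); (1, 2); (2, 1); (2, 3); (3, 0); (3, 2)].

Lemma midpointE m : is_midpoint m -> exists v a, a \in base_points /\ m = shift4 v a.
Proof.
move=> hm; exists ((m.1 %/ 4)%Z, (m.2 %/ 4)%Z), ((m.1 %% 4)%Z, (m.2 %% 4)%Z).
split; last by case: m {hm} => x y; rewrite /shift4 /=; congr pair; lia.
by move: hm; rewrite /is_midpoint !inE !xpair_eqE; lia.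
Qed.

Lemma all_base (P : pred Z2) : all P base_points -> forall a, a \in base_points -> P a.
Proof. by move=> /allP. Qed.

Definition bools : seq bool := [:: true; false].
Definition dirs : seq (bool * bool) := [seq (b, c) | b <- bools, c <- bools].
Lemma all_dirs (P : pred (bool * bool)) : all P dirs -> forall d, P d.
Proof. by move=> /allP h [[] []]; apply: h. Qed.

(* Statements about a bounded number of diagonal steps are invariant under
   translation by 4 Z^2, hence reduce to a finite computation. *)
Ltac base_case m hm v a ha := move: (midpointE hm) => [v [a [ha hE]]]; subst m; clear hm.
Ltac diag_case H d := move: (diagE H) => [d hE]; subst; clear H.

Ltac imp H := move: H; apply/implyP.
Ltac dirs_case e := move: e;
  match goal with |- forall e, is_true (@?P e) => apply: (@all_dirs P) end.
Ltac points_case a ha := move: a ha;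
  match goal with |- forall a, _ -> is_true (@?P a) => apply: (@all_base P) end.

Lemma diag_midpoint a b : diag a b -> is_midpoint a -> is_midpoint b.
Proof. by case: a b => [x y] [z w]; rewrite /diag /is_midpoint /=; lia. Qed.

Lemma diagC a b : diag a b = diag b a.
Proof. by rewrite /diag; lia. Qed.

(** The path touches [b] when it arrives and leaves on the same side of the bisected edge; then [a]
    and [c] agree in the coordinate transverse to that edge. *)
Lemma eta_touch a b c : is_midpoint a -> diag a b -> diag b c ->
  (eta a b != eta b c) = (if horizontal b then a.2 == c.2 else a.1 == c.1).
Proof.
move=> ma; base_case a ma v a0 ha => hab; diag_case hab d => hbc; diag_case hbc e.
rewrite !eta_shift4 horizontal_shift4 /= !(inj_eq (addIr _)); apply: (elimT eqP).
dirs_case e; dirs_case d; points_case a0 ha; by vm_compute.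
Qed.

(* The three steps go round a single face. *)
Lemma double_touch a b c d : is_midpoint a -> diag a b -> diag b c -> diag c d ->
  eta a b != eta b c -> eta b c != eta c d -> a != c -> b != d ->
  diag a d && (eta a d == eta a b).
Proof.
move=> ma; base_case a ma v a0 ha => h; diag_case h s1 => h; diag_case h s2 => h.
diag_case h s3; rewrite !eta_shift4 !eq_shift4 diag_shift4.
move=> k1 k2 k3 k4; imp k4; imp k3; imp k2; imp k1.
dirs_case s3; dirs_case s2; dirs_case s1; points_case a0 ha; by vm_compute.
Qed.

Definition same_turn (a b c d : Z2) : bool :=
  let t := cross (b - a) (c - b) in let t' := cross (c - b) (d - c) in
  ((0 < t) && (0 < t')) || ((t < 0) && (t' < 0)).

(* [a, b, c, d] encircle a vertex; with their neighbours [x] and [y] on the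
   path they can be short-cut by the step from [x] to [y]. *)
Lemma double_turn x a b c d y : is_midpoint x ->
  diag x a -> diag a b -> diag b c -> diag c d -> diag d y ->
  uniq [:: x; a; b; c; d; y] ->
  eta x a == eta a b -> eta a b == eta b c -> eta b c == eta c d -> eta c d == eta d y ->
  same_turn a b c d -> diag x y && (eta x y == eta x a).
Proof.
move=> mx; base_case x mx v a0 ha => h; diag_case h s1 => h; diag_case h s2 => h.
diag_case h s3 => h; diag_case h s4 => h; diag_case h s5.
rewrite /= !inE !eta_shift4 !eq_shift4 !diag_shift4 /same_turn !sub_shift4.
move=> k1 k2 k3 k4 k5 k6; imp k6; imp k5; imp k4; imp k3; imp k2; imp k1.
dirs_case s5; dirs_case s4; dirs_case s3; dirs_case s2; dirs_case s1; points_case a0 ha.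
by vm_compute.
Qed.

(** The midpoints encircle a vertex, so [b] and [d] lie on opposite sides of the line carrying the
    edge at [a], and likewise [a] and [c] for [d]. This excludes double turns at the ends of a
    spanning path, where one of the two would leave the grid. *)
Lemma double_turn_opposite a b c d : is_midpoint a ->
  diag a b -> diag b c -> diag c d ->
  eta a b == eta b c -> eta b c == eta c d -> same_turn a b c d ->
  (horizontal a ==> (((b - a) + (d - a)).2 == 0)) &&
  (horizontal d ==> (((a - d) + (c - d)).2 == 0)).
Proof.
move=> ma; base_case a ma v a0 ha => h; diag_case h s1 => h; diag_case h s2 => h.
diag_case h s3; rewrite !eta_shift4 !horizontal_shift4 /same_turn !sub_shift4.
move=> k1 k2 k3; imp k3; imp k2; imp k1.
dirs_case s3; dirs_case s2; dirs_case s1; points_case a0 ha; by vm_compute.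
Qed.

(** * Removing double touches *)

Fixpoint changes (e : bool) (l : seq bool) : nat :=
  if l is e' :: l' then ((e != e') + changes e' l')%N else 0%N.

Lemma leq_changes_cons e e' l : (changes e l <= changes e (e' :: l))%N.
Proof. by case: l => [|f l] //=; case: e; case: e'; case: f; lia. Qed.

Lemma changes_head e e' l : (changes e l <= (e != e') + changes e' l)%N.
Proof. exact: leq_changes_cons. Qed.

(** The unit vector from the even to the odd endpoint of the edge bisected by [m]. *)
Definition odd_side (m : Z2) : Z2 :=
  let s : int := if sigma m then 1 else -1 in if horizontal m then (s, 0) else (0, s).

Lemma odd_side_shift4 v m : odd_side (shift4 v m) = odd_side m.
Proof. by rewrite /odd_side horizontal_shift4 sigma_shift4. Qed.

Lemma on_left_crossing a b c : is_midpoint a -> diag a b -> diag b c ->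
  eta a b == eta b c -> on_left (b - a) (c - b) (odd_side b) == eta a b.
Proof.
move=> ma; base_case a ma v a0 ha => h; diag_case h s1 => h; diag_case h s2.
rewrite !eta_shift4 odd_side_shift4 !sub_shift4 => k1; imp k1.
dirs_case s2; dirs_case s1; points_case a0 ha; by vm_compute.
Qed.

Lemma on_left_ends a b : is_midpoint a -> diag a b ->
  (on_left (b - a) (b - a) (odd_side b) == eta a b) &&
  (on_left (b - a) (b - a) (odd_side a) == eta a b).
Proof.
move=> ma; base_case a ma v a0 ha => h; diag_case h s1.
rewrite !eta_shift4 !odd_side_shift4 !sub_shift4.
dirs_case s1; points_case a0 ha; by vm_compute.
Qed.

(** * Grid edges in doubled coordinates *)

Definition side_length n : int := (n%:Z - 1) *+ 2.

Lemma bisectsE n m (u v : vertex n) : bisects m u v ->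
  ((v.1 = u.1 + 1 :> nat)%N /\ v.2 = u.2 :> nat \/ (u.1 = v.1 + 1 :> nat)%N /\
    v.2 = u.2 :> nat \/
  (v.2 = u.2 + 1 :> nat)%N /\ v.1 = u.1 :> nat \/ (u.2 = v.2 + 1 :> nat)%N /\
    v.1 = u.1 :> nat) /\
  m = ((u.1 + v.1)%N%:Z, (u.2 + v.2)%N%:Z).
Proof.
case/andP; rewrite /grid_adj /z2_adj /= => h /eqP ->; split; last by congr pair.
by lia.
Qed.

Lemma bisectsC n m (u v : vertex n) : bisects m u v = bisects m v u.
Proof. by rewrite /bisects /grid_adj /z2_adj (addrC (pos v)); congr andb; lia. Qed.

Lemma bisects_in_box n m (u v : vertex n) : bisects m u v -> in_box (side_length n) m.
Proof.
case/bisectsE => h ->; rewrite /in_box /is_midpoint /side_length /=.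
by move: (ltn_ord u.1) (ltn_ord u.2) (ltn_ord v.1) (ltn_ord v.2); lia.
Qed.

Lemma bisects_odd_side n m (u v : vertex n) : bisects m u v -> odd_vertex u ->
  pos u - pos v = odd_side m.
Proof.
case/bisectsE => h ->; rewrite /odd_vertex /odd_side /horizontal /sigma /= => o.
have -> : pos u - pos v = ((u.1 : nat)%:Z - (v.1 : nat)%:Z,
  (u.2 : nat)%:Z - (v.2 : nat)%:Z) by [].
by (case: ifP => h1; case: ifP => h2); congr pair; lia.
Qed.

Lemma unoccupied_in_box n (I : {set vertex n}) m :
  unoccupied_edge I m -> in_box (side_length n) m.
Proof. by case/existsP=> u /existsP[v /and3P[/bisects_in_box]]. Qed.

Lemma diamond_diag n a b : diamond_adj n a b -> diag a b.
Proof.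
case/existsP=> u /existsP[v /existsP[w /and3P[/bisectsE[h ->] /bisectsE[k ->]]]].
by rewrite /dot /diag /=; nia.
Qed.

(** Exactly one endpoint of an edge is odd and the midpoint determines the edge, so the search over
    endpoints in [blue] amounts to one test on [odd_side]. *)
Lemma blueE n (I : {set vertex n}) p i : unoccupied_edge I (nth 0 p i) ->
  blue n p i = on_left (nth 0 (steps p) i.-1)
    (nth 0 (steps p) (minn i (size (steps p)).-1)) (odd_side (nth 0 p i)).
Proof.
case/existsP=> u /existsP[v /and3P[b _ _]]; apply/idP/idP.
  case/existsP=> u' /existsP[v' /and3P[b' o]].
  by rewrite (bisects_odd_side b' o).
move=> h; rewrite /blue; case: (boolP (odd_vertex u)) => [ou | nou].
  by apply/existsP; exists u; apply/existsP; exists v;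
     rewrite b ou (bisects_odd_side b ou).
have ov : odd_vertex v.
  by move: nou; rewrite /odd_vertex; case: (bisectsE b); lia.
have b' : bisects (nth 0 p i) v u by rewrite bisectsC.
by apply/existsP; exists v; apply/existsP; exists u; rewrite b' ov (bisects_odd_side b' ov).
Qed.

(* [colours_ok a b s l]: [l] is a possible list of colours of [b :: s] when the
   path arrives from [a]; nothing is required where the path merely touches. *)
Fixpoint colours_ok (a b : Z2) (s : seq Z2) (l : seq bool) : bool :=
  match s, l with
  | [::], [:: x] => x == eta a b
  | c :: s', x :: l' => ((eta a b == eta b c) ==> (x == eta a b)) && colours_ok b c s' l'
  | _, _ => false
  end.

Lemma steps_cat r a s :
  steps (r ++ a :: s) = steps (rcons r a) ++ pairmap (fun a b => b - a) a s.
Proof.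
by case: r => [|y r] //=; rewrite -cat_rcons pairmap_cat last_rcons.
Qed.

(** The prefix [r] serves the induction: [blue] refers to positions in the whole path, while
    [colours_ok] reads only a final piece of it. *)
Lemma colours_blue n (I : {set vertex n}) r a b s :
  path diag a (b :: s) -> is_midpoint a ->
  all (unoccupied_edge I) (b :: s) ->
  colours_ok a b s
    (mkseq (fun i => blue n (r ++ a :: b :: s) (i + (size r).+1)%N) (size s).+1).
Proof.
elim: s r a b => [|c s IH] r a b /=.
  move=> /andP[hab _] ma /andP[ob _].
  rewrite add0n (blueE (I := I)); last by rewrite nth_cat ltnNge leqnSn subSnn.
  have -> : nth 0 (r ++ [:: a; b]) (size r).+1 = b by rewrite nth_cat ltnNge leqnSn subSnn.
  have hs : steps (r ++ [:: a; b]) = rcons (steps (rcons r a)) (b - a).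
    by rewrite steps_cat cats1.
  have hsz : size (steps (rcons r a)) = size r.
    by case: (r) => [|y r'] //=; rewrite size_pairmap size_rcons.
  (* The last midpoint has no leaving step; [minn] falls back on the last step, which is also the
     arriving one. *)
  rewrite hs size_rcons hsz /= (minn_idPr (leqnSn _)).
  rewrite !nth_rcons hsz ltnn eqxx.
  by case/andP: (on_left_ends ma hab).
move=> /and3P[hab hbc hp] ma /and3P[ob oc hall].
have mb := diag_midpoint hab ma.
have hs : steps (r ++ [:: a, b, c & s]) =
    steps (rcons r a) ++ [:: b - a, c - b & pairmap (fun a b => b - a) c s].
  exact: steps_cat.
have hsz : size (steps (rcons r a)) = size r.
  by case: (r) => [|y r'] //=; rewrite size_pairmap size_rcons.
apply/andP; split.
  apply/implyP=> he.
  have hn : nth 0 (r ++ [:: a, b, c & s]) (size r).+1 = b.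
    by rewrite nth_cat ltnNge leqnSn subSnn.
  rewrite add0n (blueE (I := I)) hn // hs size_cat hsz /=.
  have -> : minn (size r).+1 (size r + (size (pairmap (fun a0 b0 : Z2 =>
    b0 - a0) c s)).+2).-1
    = (size r).+1 by lia.
  rewrite !nth_cat hsz ltnn subnn ltnNge leqnSn subSnn /=.
  exact: on_left_crossing.
have := IH (rcons r a) b c; rewrite size_rcons cat_rcons => /(_ _ mb) h.
have {}h := h (introT andP (conj hbc hp)).
have {}h := h (introT andP (conj oc hall)).
apply: (eq_ind _ (fun l => colours_ok b c s l) h).
rewrite /mkseq -[RHS]/(map _ (iota (1 + 0) (size s).+1)) iotaDl -map_comp.
by apply: eq_map => i /=; congr blue; lia.
Qed.

Definition etas (p : seq Z2) : seq bool := if p is a :: s then pairmap eta a s else [::].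

(* Two consecutive touches are short-cut by [double_touch]; an isolated touch makes
   the colours of its two neighbours differ, so it costs an alternation. *)
Lemma compress a b s l : path diag a (b :: s) -> is_midpoint a ->
  uniq (a :: b :: s) -> colours_ok a b s l ->
  exists b' s', [/\ subseq (b' :: s') (b :: s), last b' s' = last b s,
    path diag a (b' :: s'), eta a b' = eta a b &
    (changes (eta a b') (pairmap eta b' s') <= changes (eta a b) l)%N].
Proof.
(* Keeping [eta] on the first step allows a shortened tail to be attached to the preceding midpoint.
   The induction is on the size, since a double touch removes two midpoints at once. *)
have [k] := ubnP (size s); elim: k => // k IH in a b s l *; rewrite ltnS => hk.
case: s hk => [|c s] hk hp ma hu.
  by move=> _; exists b, [::].
case: l => [|x l]; first by []. 
move=> /andP[hx hl].
move: (hp) => /= /and3P[hab hbc hps].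
have mb := diag_midpoint hab ma; have mc := diag_midpoint hbc mb.
have hub : uniq (b :: c :: s) by case/andP: hu.
have [e|ne] := boolP (eta a b == eta b c).
  rewrite (eqP (implyP hx e)).
  have [c' [s' [h1 h2 h3 h4 h5]]] := IH b c s l hk (introT andP (conj hbc hps)) mb hub hl.
  exists b, (c' :: s'); split => //=.
  - by rewrite eqxx.
  - by rewrite hab.
  - by move: h5; rewrite h4 (eqP e) eqxx.
case: s hk hp hu hps hl hub => [|d s] hk hp hu hps hl hub.
  case: l hl => [|y []] // /eqP -> ; exists b, [:: c]; split; rewrite //= ?eqxx //.
  by rewrite /=; move: ne; case: (eta a b); case: (eta b c); case: x {hx}.
case: l hl => [|y l] // /andP[hy hl]; move: (hps) => /= /andP[hcd hpd].
have md := diag_midpoint hcd mc.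
have [e2|ne2] := boolP (eta b c == eta c d).
  have [c' [s' [h1 h2 h3 h4 h5]]] := IH b c (d :: s) (y :: l) hk
    (introT andP (conj hbc hps)) mb hub (introT andP (conj hy hl)).
  exists b, (c' :: s'); split => //=.
  - by rewrite eqxx.
  - by rewrite hab.
  - move: h5; rewrite /= (eqP (implyP hy e2)) h4 eqxx.
    by move: ne; case: (eta a b); case: (eta b c); case: x {hx} => //= _ h;
      rewrite ?add0n ?add1n ?ltnS //; apply: leqW.
(* Touches at [b] and at [c]: both are skipped, and the path goes directly from [a] to [d]. *)
have [h1 h2] : diag a d /\ eta a d == eta a b.
  apply/andP; apply: (double_touch ma hab hbc hcd ne ne2).
    by move: hu; rewrite /= !inE !negb_or => /andP[/and3P[]].
  by move: hub; rewrite /= !inE !negb_or => /andP[/and3P[]].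
have hu' : uniq (a :: d :: s).
  by move: hu; rewrite /= !inE !negb_or => /and4P[/and4P[_ _ -> ->] _ _ /andP[-> ->]].
have ecd : eta c d == eta a b by move: ne ne2; case: (eta a b); case: (eta b c);
  case: (eta c d).
have hl' : colours_ok a d s l.
  case: s hl hpd {hk hp hu hps hub hu'} => [|f s] /=.
    by case: l => [|z []] // /eqP -> _; rewrite (eqP h2) ecd.
  by case: l => [|z l] //; rewrite (eqP h2) (eqP ecd).
have hk' : (size s < k)%N := ltnW hk.
have [d' [s' [k1 k2 k3 k4 k5]]] := IH a d s l hk' (introT andP (conj h1 hpd)) ma hu' hl'.
have hsub : subseq (d :: s) [:: b, c, d & s].
  exact: subseq_trans (subseq_cons _ c) (subseq_cons _ b).
exists d', s'; split => //.
- exact: subseq_trans k1 hsub.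
- by rewrite k4 (eqP h2).
- apply: (leq_trans k5); rewrite (eqP h2) /=.
  by apply: (leq_trans (changes_head _ x _)); rewrite leq_add2l; apply: changes_head.
Qed.

(** * Reduction to crossing paths between bottom and top *)

Definition alternation_count (l : seq bool) : nat :=
  if l is e :: l' then changes e l' else 0%N.

Lemma count_changes (f : nat -> bool) k m :
  count (fun i => f i != f i.+1) (iota k m) = changes (f k) (map f (iota k.+1 m)).
Proof. by elim: m k => //= m IH k; rewrite IH. Qed.

(** Both directions occur, because the reflection turns a path from left to right into one from
    bottom to top. *)
Definition spans (N : int) (x y : Z2) : bool :=
  ((x.2 == N) && (y.2 == 0)) || ((x.2 == 0) && (y.2 == N)).

Definition crossing_path (N : int) (p : seq Z2) : bool :=
  if p is x :: s then
    [&& path diag x s, uniq p, all (in_box N) p, spans N x (last x s)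
      & (alternation_count (etas p) <= 1)%N]
  else false.

(* A path from left to right is turned into a vertical one by the reflection in the
   diagonal, which preserves parity. *)
Definition flip (m : Z2) : Z2 := (m.2, m.1).

Lemma flipK : involutive flip. Proof. by case. Qed.

Definition flip_set n (I : {set vertex n}) : {set vertex n} := [set v | (v.2, v.1) \in I].

Lemma diag_flip a b : diag (flip a) (flip b) = diag a b.
Proof. by rewrite /diag /= andbC. Qed.

Lemma in_box_flip N a : in_box N (flip a) = in_box N a.
Proof. by rewrite /in_box /is_midpoint /= addrC; congr andb; rewrite andbC. Qed.

(** The reflection preserves parities and exchanges left and right. *)
Lemma eta_flip a b : is_midpoint a -> diag a b -> eta (flip a) (flip b) = ~~ eta a b.
Proof.
case: a b => [x y] [z w]; rewrite /is_midpoint /diag /eta /sigma /horizontal /=.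
move=> h /andP[h1 h2]; rewrite [y + x]addrC.
have -> : odd `|y|%N = ~~ odd `|x|%N by move: h; clear; lia.
have -> : (w < y) = ~~ (y < w) by move: h2; clear; lia.
have -> : (z < x) = ~~ (x < z) by move: h1; clear; lia.
by case: (odd _); case: (y < w); case: (x < z); case: (((x + y) %% 4)%Z == 1).
Qed.

Lemma etas_flip a s : is_midpoint a -> path diag a s ->
  etas (map flip (a :: s)) = map negb (etas (a :: s)).
Proof.
rewrite /=; elim: s a => //= b s IH a ma /andP[hab hs].
by rewrite eta_flip // IH // (diag_midpoint hab).
Qed.

Lemma alternation_count_negb l : alternation_count (map negb l) = alternation_count l.
Proof.
case: l => //= e l; elim: l e => //= f l IH e.
by rewrite IH (inj_eq negb_inj).
Qed.

Lemma unoccupied_flip n (I : {set vertex n}) m :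
  unoccupied_edge I m -> unoccupied_edge (flip_set I) (flip m).
Proof.
case/existsP=> u /existsP[v /and3P[b iu iv]].
apply/existsP; exists (u.2, u.1); apply/existsP; exists (v.2, v.1).
rewrite /flip_set !inE -!surjective_pairing iu iv !andbT.
case/andP: b; rewrite /bisects /grid_adj /z2_adj /= addrC => -> /eqP ->.
exact: eqxx.
Qed.

Lemma fault_line_reduce n (I : {set vertex n}) p : fault_line I p ->
  exists a s, [/\ path diag a s, uniq (a :: s), all (unoccupied_edge I) (a :: s),
    top_to_bottom n a (last a s) || left_to_right n a (last a s)
    & (alternation_count (etas (a :: s)) <= 1)%N].
Proof.
case: p => // a s /andP[/and4P[hp hu ho he] halt].
have {}hp : path diag a s by apply: sub_path hp => x y; apply: diamond_diag.
have ba : in_box (side_length n) a by apply: (unoccupied_in_box (I := I)); case/andP: ho.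
have ma : is_midpoint a by case/and3P: ba.
case: s hp hu ho he halt => [|b s] hp hu ho he halt.
  (* A single midpoint could only span a box of side 0, which contains no midpoint. *)
  exfalso; move: he ba; rewrite /top_to_bottom /left_to_right /in_box /is_midpoint
    /side_length /=.
  by clear; lia.
have hob : all (unoccupied_edge I) (b :: s) by case/andP: ho.
have hc := colours_blue [::] hp ma hob.
move: (hp) => /= /andP[hab _].
have h0 : blue n [:: a, b & s] 0 = eta a b.
  rewrite (blueE (I := I)) /=; last by case/andP: ho.
  by apply/eqP; case/andP: (on_left_ends ma hab); rewrite min0n.
have [b' [s' [h1 h2 h3 h4 h5]]] := compress hp ma hu hc.
have sub : subseq [:: a, b' & s'] [:: a, b & s] by rewrite /= eqxx.
have hall : all (unoccupied_edge I) [:: a, b' & s'].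
  by apply/allP => x hx; exact: (allP ho _ (mem_subseq sub hx)).
exists a, (b' :: s'); split => //.
- exact: subseq_uniq sub hu.
- by move: he; rewrite /= h2.
- apply: (leq_trans h5); move: halt; rewrite /alternations count_changes h0 /=.
  rewrite -[2%N]/(1 + 1)%N iotaDl -map_comp add0n.
  by rewrite (eq_map (g := blue n [:: a, b & s] \o addn 1)) // => i; rewrite /= addnC.
Qed.

Lemma fault_line_crossing n (I : {set vertex n}) p : fault_line I p ->
  exists q, crossing_path (side_length n) q /\
    (all (unoccupied_edge I) q \/ all (unoccupied_edge (flip_set I)) q).
Proof.
case/fault_line_reduce => a [s [hp hu ho he ha]].
have hb : all (in_box (side_length n)) (a :: s).
  by apply: sub_all ho => x; apply: unoccupied_in_box.
have ma : is_midpoint a by case/andP: hb => /and3P[].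
case/orP: he => he.
  exists (a :: s); split; last by left.
  by rewrite /crossing_path hp hu hb ha /spans; move: he; rewrite /top_to_bottom => ->.
exists (map flip (a :: s)); split; last first.
  right; rewrite all_map; apply: sub_all ho => x; exact: unoccupied_flip.
rewrite /crossing_path /= -/(map flip (a :: s)).
have -> : path diag (flip a) (map flip s).
  by rewrite path_map; apply: sub_path hp => x y; rewrite /= diag_flip.
have := map_inj_uniq (inv_inj flipK) (a :: s); rewrite /= => ->.
rewrite in_box_flip all_map (eq_all (in_box_flip _)) last_map.
have := etas_flip ma hp; rewrite /= => ->.
move: hu hb ha; rewrite -(alternation_count_negb (etas _)) /= => -> -> ->.
by rewrite /spans /=; move: he => /andP[/eqP -> /eqP ->]; rewrite !eqxx orbT.
Qed.

(** * Removing double turns *)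

Lemma changes_subseq e l1 l2 : subseq l1 l2 -> (changes e l1 <= changes e l2)%N.
Proof.
elim: l2 l1 e => [|y l2 IH] [|x l1] e //=.
case: eqP => [-> h|_ h]; first by rewrite leq_add2l IH.
exact: leq_trans (IH _ e h) (leq_changes_cons _ _ _).
Qed.

Lemma alternation_count_subseq l1 l2 : subseq l1 l2 ->
  (alternation_count l1 <= alternation_count l2)%N.
Proof.
elim: l2 l1 => [|y l2 IH] [|x l1] //=.
case: eqP => [-> h|_ h]; first exact: changes_subseq.
apply: leq_trans (IH _ h) _; case: l2 {IH h} => //= z l2.
by rewrite leq_addl.
Qed.

Lemma alternation_count_le1 e f l : (alternation_count [:: e, f & l] <= 1)%N ->
  exists i j e1 e2, [:: e, f & l] = nseq i.+1 e1 ++ nseq j.+1 e2.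
Proof.
have H k g : (changes k g <= 1)%N -> exists i j, k :: g = nseq i.+1 k ++ nseq j (~~ k).
  have H0 k' g' : changes k' g' = 0%N -> g' = nseq (size g') k'.
    by elim: g' => //= x g' IH; case: eqP => //= <- /IH {1}->.
  elim: g k => [|x g IH] k /=; first by exists 0%N, 0%N.
  have [<- /IH[i [j ->]]|ne] := eqVneq k x; first by exists i.+1, j.
  move=> h; exists 0%N, (size g).+1 => /=.
  have -> : ~~ k = x by case: (k) (x) ne => [] [].
  by congr [:: _, _ & _]; apply: H0; move: h; clear; lia.
move=> /H[i [[|j] h]]; last by exists i, j, e, (~~ e).
(* Without a change the last entry becomes the second block, so that both blocks are nonempty. *)
move: h; rewrite cats0 => h; case: i h => // i h.
exists i, 0%N, e, e; rewrite h -[RHS]/(nseq i.+1 e ++ nseq 1 e) -nseqD.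
by rewrite addn1.
Qed.

Lemma etas_cat r a s : etas (r ++ a :: s) = etas (rcons r a) ++ pairmap eta a s.
Proof. by case: r => [|y r] //=; rewrite -cat_rcons pairmap_cat last_rcons. Qed.

Lemma size_etas p : size (etas p) = (size p).-1.
Proof. by case: p => //= a s; rewrite size_pairmap. Qed.

Lemma path_cat_cons (e : rel Z2) x r a s : path e x (r ++ a :: s) = path e x (rcons r a)
  && path e a s.
Proof. by rewrite -cat_rcons cat_path last_rcons. Qed.

Definition diag_path (p : seq Z2) : bool := if p is a :: s then path diag a s else true.

Lemma diag_path_cat r a s : diag_path (r ++ a :: s) = diag_path (rcons r a) &&
  path diag a s.
Proof. by case: r => [|y r] //=; rewrite path_cat_cons. Qed.

Lemma crossing_pathE N p : crossing_path N p =
  [&& diag_path p, uniq p, all (in_box N) p, spans N (head 0 p) (last 0 p) &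
    (alternation_count (etas p) <= 1)%N]
    && (0 < size p)%N.
Proof. by case: p => [|a s]; rewrite /crossing_path ?andbF //= !andbT. Qed.

Definition turn_free (q : seq Z2) := forall r1 a b c d r2,
  q = r1 ++ [:: a, b, c, d & r2] -> ~~ same_turn a b c d.

(** The short-cut of [double_turn] would give a crossing path with four midpoints fewer: a
    subsequence inherits [O] and the box, the ends stay, and the deleted values of [eta] equal the
    remaining one. *)
Lemma minimal_no_turn N (O : pred Z2) q : crossing_path N q -> all O q ->
  (forall q', crossing_path N q' -> all O q' -> (size q <= size q')%N) ->
  forall r1 x a b c d y r2 e, q = r1 ++ [:: x, a, b, c, d, y & r2] ->
  all (pred1 e) (pairmap eta x [:: a; b; c; d; y]) -> ~~ same_turn a b c d.
Proof.
move=> hq ho hmin r1 x a b c d y r2 e E he; apply/negP => ht.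
move: hq ho hmin; rewrite {}E {q}.
set q := _ ++ _; pose q' := r1 ++ [:: x, y & r2] => hq ho hmin.
have sub : subseq q' q.
  rewrite /q /q'; apply: cat_subseq => //.
  apply: (@cat_subseq _ [:: x] [:: y & r2] [:: x] [:: a, b, c, d, y & r2]) => //.
  exact: (suffix_subseq [:: a; b; c; d]).
suff h' : crossing_path N q'.
  have h'' : all O q' by apply/allP => z hz; exact: (allP ho _ (mem_subseq sub hz)).
  have := hmin _ h' h''; rewrite /q /q' !size_cat /= leq_add2l.
  by move: (size r2) => ?; clear; lia.
move: hq; rewrite !crossing_pathE => /andP[/and5P[h1 h2 h3 h4 h5] _].
move: h1; rewrite diag_path_cat => /andP[k1].
rewrite /= => /and5P[k2 k3 k4 k5 /andP[k6 k7]].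
move: he; rewrite /= => /and5P[/eqP e1 /eqP e2 /eqP e3 /eqP e4 /andP[/eqP e5 _]].
have mx : is_midpoint x.
  have : in_box N x by apply: (allP h3); rewrite mem_cat inE eqxx orbT.
  by case/and3P.
have hu : uniq [:: x; a; b; c; d; y].
  apply: subseq_uniq h2; rewrite /q -[[:: x, a, b, c, d, y & r2]]/([:: x; a; b; c; d;
    y] ++ r2).
  apply: (subseq_trans (prefix_subseq _ r2)); exact: suffix_subseq.
have /andP[hxy /eqP exy] : diag x y && (eta x y == eta x a).
  by apply: (double_turn mx k2 k3 k4 k5 k6 hu); rewrite ?e1 ?e2 ?e3 ?e4 ?e5.
apply/andP; split; last by rewrite /q' size_cat addnS.
apply/and5P; split.
- by rewrite /q' diag_path_cat k1 /= hxy.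
- exact: subseq_uniq sub h2.
- by apply/allP => z hz; exact: (allP h3 _ (mem_subseq sub hz)).
- by move: h4; rewrite /q /q'; case: (r1) => [|z r1'] //=; rewrite !last_cat.
- apply: leq_trans (alternation_count_subseq _) h5.
  rewrite /q /q' !etas_cat; apply: cat_subseq => //=.
  rewrite exy e1 e2 e3 e4 e5 eqxx.
  exact: (suffix_subseq [:: e; e; e; e]).
Qed.

Lemma diag_path_height x s : path diag x s -> `|x.2 - (last x s).2| <= (size s)%:Z.
Proof.
elim: s x => [|y s IH] x /=; first by rewrite subrr.
by case/andP; rewrite /diag => h /IH; move: h; case: (last y s) => u v; clear; lia.
Qed.

Lemma crossing_path_size N p : crossing_path N p -> N%R < (size p)%:Z.
Proof.
case: p => // a s /and5P[/diag_path_height h _ _ hs _].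
by move: h hs; rewrite /spans /=; case: (last a s) => u v; clear; lia.
Qed.

(* Take a shortest path. *)
Lemma crossing_path_decomposition (k : nat) (O : pred Z2) p (N := k%:Z *+ 2) :
  crossing_path N p -> all O p ->
  exists q1 t q2 e1 e2, let q := q1 ++ t :: q2 in
    [/\ crossing_path N q, all O q, (0 < size q1)%N && (0 < size q2)%N,
        all (pred1 e1) (etas q1) && all (pred1 e2) (etas q2)
      & turn_free q1 /\ turn_free q2].
Proof.
move=> hp hop.
pose P m := `[< exists q, [/\ crossing_path N q, all O q & size q = m] >].
have exP : exists m, P m by exists (size p); apply/asboolP; exists p.
have [m /asboolP[q [hq ho hm]] hmin] := ex_minnP exP.
have {}hmin q' : crossing_path N q' -> all O q' -> (size q <= size q')%N.
  by move=> h1 h2; rewrite hm; apply: hmin; apply/asboolP; exists q'.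
have hno := minimal_no_turn hq ho hmin.
have hsz := crossing_path_size hq.
have [h1 h2 h3 h4 h5] : [/\ diag_path q, uniq q, all (in_box N) q,
  spans N (head 0 q) (last 0 q) & (alternation_count (etas q) <= 1)%N].
  by move: hq; rewrite crossing_pathE => /andP[/and5P[]].
have k0 : (0 < k)%N.
  rewrite lt0n; apply/eqP => k0; case: q hsz h3 {hq ho hm hmin hno h1 h2 h4 h5} =>
    // a s _ /andP[].
  by rewrite /in_box /is_midpoint /N k0; case: a => x y /=; clear; lia.
have hsz3 : (2 < size q)%N by move: hsz k0; rewrite /N; clear; lia.
case Eq : q hsz3 => [|v0 [|v1 [|v2 s]]] // _.
have [i [j [e1 [e2 He]]]] : exists i j e1 e2, etas q = nseq i.+1 e1 ++ nseq j.+1 e2.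
  by move: h5; rewrite Eq /=; apply: alternation_count_le1.
have hij : size q = (i.+1 + j.+1).+1.
  by have := size_etas q; rewrite He size_cat !size_nseq Eq /= => ->.
(* The first [i.+1] steps join the vertices of [rcons q1 t], so [eta] can change only at [t]. *)
pose q1 := take i.+1 q; pose t := nth 0 q i.+1; pose q2 := drop i.+2 q.
have Q : q = q1 ++ t :: q2 by rewrite /q1 /t /q2 -drop_nth ?cat_take_drop // hij; clear;
  lia.
have s1 : size q1 = i.+1 by rewrite /q1 size_takel // hij; clear; lia.
have s2 : size q2 = j.+1 by rewrite /q2 size_drop hij; clear; lia.
move: He; rewrite Q etas_cat => /eqP; rewrite eqseq_cat; last first.
  by rewrite size_etas size_rcons s1 size_nseq.
case/andP=> /eqP E1 /eqP E2.
have hN z : z \in q -> z.2 = 0 \/ z.2 = N -> horizontal z.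
  move=> /(allP h3); case: z => x y; rewrite /in_box /is_midpoint /horizontal /N /=.
  by clear; lia.
have box z : z \in q -> 0 <= z.2 <= N by move=> /(allP h3) /and3P[].
exists q1, t, q2, e1, e2; rewrite -Q; split => //.
- by rewrite s1 s2.
- have -> : all (pred1 e1) (etas q1).
    move: E1; case: (q1) s1 => // a r _ E1.
    have : subseq (pairmap eta a r) (nseq i.+1 e1).
      by rewrite -E1 /= -cats1 pairmap_cat prefix_subseq.
    by move/mem_subseq => h; apply/allP => z /h /nseqP[-> _] /=.
  move: E2 s2; case: (q2) => // a r [_ E2] _ /=.
  by rewrite E2; apply/allP => z /nseqP[-> _] /=.
(* A double turn at an end of the whole path lacks an outer neighbour for the short-cut, but there
   it would force the path out of the box. *)
- have hends a b c d r1 r2 : q = r1 ++ [:: a, b, c, d & r2] ->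
     eta a b == eta b c -> eta b c == eta c d -> r1 = [::] \/ r2 = [::] ->
       ~~ same_turn a b c d.
    move=> E eb ec hr; apply/negP => ht.
    have [ia ib ic jd] : [/\ a \in q, b \in q, c \in q & d \in q].
      by rewrite E !mem_cat !inE !eqxx !orbT.
    have ma : is_midpoint a by case/and3P: (allP h3 _ ia).
    move: h1; rewrite E diag_path_cat /= => /andP[_ /and4P[d1 d2 d3 _]].
    have /andP[oa od] := double_turn_opposite ma d1 d2 d3 eb ec ht.
    case: hr => hr.
      have ha : a.2 = 0 \/ a.2 = N.
        by move: h4; rewrite E hr /spans /=; case/orP => /andP[/eqP]; [right|left].
      move: oa; rewrite (hN _ ia ha) /=; move: (box _ ib) (box _ jd) d1 ha.
      case: a b d {E eb ec ht ia ib jd ma d2 d3 od} => [x y] [z w] [u v].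
      by rewrite /diag /=; clear; lia.
    have ha : d.2 = 0 \/ d.2 = N.
      by move: h4; rewrite E hr last_cat /spans /=; case/orP => /andP[_ /eqP]; [left|right].
    move: od; rewrite (hN _ jd ha) /=; move: (box _ ia) (box _ ic) d3 ha.
    case: a c d {E eb ec ht ia ic jd ma d1 d2 oa} => [x y] [z w] [u v].
    by rewrite /diag /=; clear; lia.
  have hall r x e w : all (pred1 e) (etas (r ++ x :: w)) -> all (pred1 e) (pairmap eta x w).
    by rewrite etas_cat all_cat => /andP[].
  have A1 : all (pred1 e1) (etas (rcons q1 t)).
    by rewrite E1; apply/allP => z /nseqP[-> _] /=.
  have A2 : all (pred1 e2) (etas (t :: q2)).
    by rewrite /= E2; apply/allP => z /nseqP[-> _] /=.
  split=> r1 a b c d r2 E.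
    have := A1; rewrite E -cats1 -catA /= => /hall /= /and4P[/eqP eb /eqP ec /eqP ed _].
    case: (lastP r1) E => [|r1' x] E.
      by apply: (@hends a b c d [::] (r2 ++ t :: q2)); rewrite ?eb ?ec ?ed //;
        [rewrite Q E|left].
    (* If the turn is at the end of [q1], the outer neighbour is [t]. *)
    pose y := head t r2.
    have Ey : r2 ++ [:: t] = y :: behead (r2 ++ [:: t]) by rewrite /y; case: (r2).
    apply: (@hno r1' x a b c d y (behead (r2 ++ [:: t]) ++ q2) e1).
      by rewrite -[[:: x, a, b, c, d, y & _]]/([:: x; a; b; c; d] ++
        (y :: behead (r2 ++ [:: t])) ++ q2) -Ey Q E -cats1 -!catA.
    have := A1; rewrite E -cats1 -cats1 -!catA /= => /hall /=.
    by rewrite Ey /= => /and5P[-> -> -> -> /andP[-> _]].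
  have := A2; rewrite E -cat_cons => /hall /= /and4P[/eqP eb /eqP ec /eqP ed _].
  case: r2 E => [|y r2] E.
    by apply: (@hends a b c d (q1 ++ t :: r1) [::]); rewrite ?eb ?ec ?ed //;
      [rewrite Q E -catA|right].
  (* Symmetrically, [t] precedes a turn with which [q2] begins. *)
  have [r0 [x Ex]] : exists r0 x, t :: r1 = rcons r0 x by exists (belast t r1),
    (last t r1); rewrite lastI.
  apply: (@hno (q1 ++ r0) x a b c d y r2 e2).
    by rewrite Q E -cat_cons Ex -cats1 -!catA.
  have := A2; rewrite E -cat_cons Ex -cats1 -catA /= => /hall /=.
  by move=> /and5P[-> -> -> -> /andP[-> _]].
Qed.

(** * Taxi walks *)

Definition walk_from (u : Z2) (s : seq (bool * bool)) : seq Z2 :=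
  scanl (fun x d => x + unit_step d) u s.

Definition sg (e : bool) : int := if e then -1 else 1.

Definition flip_step (e1 e2 : bool) (d : bool * bool) : bool * bool :=
  (d.1, d.2 (+) (if d.1 then e2 else e1)).

Lemma unit_step_flip e1 e2 d :
  unit_step (flip_step e1 e2 d) = (sg e1 * (unit_step d).1, sg e2 * (unit_step d).2).
Proof. by case: d => [[] []]; case: e1; case: e2. Qed.

Definition scaled_cross (g : Z2 -> Z2) (k : int) := forall a b c : Z2,
  cross (g b - g a) (g c - g b) = k * cross (b - a) (c - b).

(** A negative factor exchanges left and right turns, but two equal turns remain equal. *)
Lemma turn_free_map g k w : k != 0 -> scaled_cross g k ->
  turn_free (map g w) -> turn_free w.
Proof.
move=> k0 hg h r1 a b c d r2 E.
have := h (map g r1) (g a) (g b) (g c) (g d) (map g r2).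
rewrite E map_cat => /(_ erefl); rewrite /same_turn !hg.
set x := cross _ _; set y := cross _ _; move: k0; clear.
by case: (ltgtP k 0) => // hk _; [rewrite !nmulr_rgt0 // !nmulr_rlt0 //|rewrite
  !pmulr_rgt0 // !pmulr_rlt0 //]; rewrite // orbC.
Qed.

Lemma no_repeated_turn_behead x w : no_repeated_turn (x :: w) -> no_repeated_turn w.
Proof. by case: w => [|a [|b w]] //; apply: path_sorted. Qed.

Lemma turn_freeP w : turn_free w <-> no_repeated_turn w.
Proof.
split; last first.
  move=> h r1 a b c d r2 E; move: h; rewrite {}E.
  elim: r1 => [|x r1 IH]; first by rewrite /turns /= => /andP[]; rewrite -negb_or.
  by move/no_repeated_turn_behead.
elim: w => [|a [|b [|c [|d w]]] IH] // h.
have /IH : turn_free [:: b, c, d & w].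
  by move=> r1 a' b' c' d' r2 E; apply: (h (a :: r1) _ _ _ _ r2); rewrite E.
rewrite /no_repeated_turn /turns /= => ->; rewrite andbT -negb_or.
exact: (h [::] _ _ _ _ w).
Qed.

(* The image of [w] under a rotation by 45 degrees: unit steps become diagonal. *)
Definition rotated (e1 e2 : bool) (x w : Z2) : Z2 :=
  x + (sg e1 * w.1 + sg e2 * w.2, sg e1 * w.1 - sg e2 * w.2).

(** The coordinate sum grows by [2 * sg e1 * w.1], and modulo 4 only the parity of [w.1] counts. *)
Lemma rotated_sigma e1 e2 x w : is_midpoint x ->
  sigma (rotated e1 e2 x w) = sigma x (+) odd `|w.1|%N.
Proof.
case: x w => [x y] [z w]; rewrite /is_midpoint /sigma /rotated /sg /= => h.
have [k ->] : exists k, y = 2 * k + 1 - x by exists ((x + y - 1) %/ 2)%Z; move: h; clear;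
  lia.
have H m : ((2 * m + 1) %% 4 == 1)%Z = ~~ odd `|m|%N by clear; lia.
set i := if e1 then _ else _; set j := if e2 then _ else _.
have -> : x + (i * z + j * w) + (2 * k + 1 - x + (i * z - j * w)) = 2 * (k + i * z) + 1
  by ring.
have -> : x + (2 * k + 1 - x) = 2 * k + 1 by ring.
rewrite !H {}/i; have -> : odd `|(k + (if e1 then -1 else 1) * z)%R|%N = odd `|k|%N (+)
  odd `|z|%N.
  by case E : (odd `|z|%N); case F : (odd `|k|%N); case: e1; rewrite /= ?mul1r ?mulN1r;
    move: E F; clear; lia.
by rewrite addNb.
Qed.

Lemma rotated_horizontal e1 e2 x w :
  horizontal (rotated e1 e2 x w) = horizontal x (+) odd `|w.1|%N (+) odd `|w.2|%N.
Proof.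
case: x w => [x y] [z w]; rewrite /horizontal /rotated /sg /=.
case E : (odd `|z|%N); case F : (odd `|w|%N); case G : (odd `|x|%N); case: e1; case: e2;
  rewrite /= ?mul1r ?mulN1r ?opprK; move: E F G; clear; lia.
Qed.

Lemma rotated_add e1 e2 x w v : rotated e1 e2 x (w + v) = rotated e1 e2 x w +
  (sg e1 * v.1 + sg e2 * v.2, sg e1 * v.1 - sg e2 * v.2).
Proof. by congr pair => /=; ring. Qed.

(** This is where the Manhattan lattice comes from: for fixed [x], [e1], [e2], and apart from the
    sign of the step, [eta] depends only on the parity of [w.1] for vertical steps and of [w.2] for
    horizontal ones. Constant [eta] thus fixes a direction on each line. *)
Lemma eta_rotated e1 e2 x w d : is_midpoint x ->
  eta (rotated e1 e2 x w) (rotated e1 e2 x (w + unit_step d)) =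
  (if d.1 then sigma x (+) odd `|w.1|%N
   else (sigma x == ~~ horizontal x) (+) odd `|w.2|%N)
  (+) ~~ (flip_step e1 e2 d).2.
Proof.
move=> mx; rewrite rotated_add /eta rotated_sigma // rotated_horizontal.
set m := rotated _ _ _ _; case: m => m1 m2 /=.
have E1 z : (z + 1 < z :> int) = false by lia.
have E2 z : (z < z + 1 :> int) = true by lia.
have E3 z : (z - 1 < z :> int) = true by lia.
have E4 z : (z < z - 1 :> int) = false by lia.
case: d => [[] []] /=; case: e1; case: e2;
  rewrite /= /sg ?mulr0 ?mul1r ?mulN1r ?mulrN1 ?opprK ?add0r ?addr0 ?sub0r ?oppr0 ?opprK
    ?E1 ?E2 ?E3 ?E4;
  by case: (sigma x); case: (horizontal x); case: (odd `|w.1|%N); case: (odd `|w.2|%N).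
Qed.

Lemma arc_of_eta e1 e2 e x w d : is_midpoint x ->
  e1 = ((sigma x == ~~ horizontal x) != e) -> e2 = (sigma x != e) ->
  eta (rotated e1 e2 x w) (rotated e1 e2 x (w + unit_step d)) = e ->
  manhattan_arc w (w + unit_step d).
Proof.
move=> mx -> ->; rewrite eta_rotated // /manhattan_arc !(inj_eq (addrI _)) /orientation.
by case: d => [[] []] /=; case: (sigma x == ~~ horizontal x); case: (sigma x);
  case: e; case: (odd `|w.1|%N); case: (odd `|w.2|%N).
Qed.

Lemma diag_rotated e1 e2 x w m : diag (rotated e1 e2 x w) m ->
  exists d, m = rotated e1 e2 x (w + unit_step d).
Proof.
rewrite /diag => /andP[/eqP h1 /eqP h2].
have [a [b E]] : exists a b : bool, m = rotated e1 e2 x w + (sg a, sg b).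
  move: h1 h2; case: (rotated _ _ _ _) m => [z t] [u v] /= h1 h2.
  exists (u < z), (v < t); rewrite /sg; congr pair; move: h1 h2; clear => /=; case: ifP;
    lia.
exists (flip_step e1 e2 (a != b, ~~ a)); rewrite E rotated_add; congr (_ + _).
by case: a {E}; case: b; case: e1 {h1 h2}; case: e2.
Qed.

Lemma rotated_path e x w s (e1 := (sigma x == ~~ horizontal x) != e) (e2 := sigma x != e) :
  is_midpoint x -> path diag (rotated e1 e2 x w) s ->
  all (pred1 e) (pairmap eta (rotated e1 e2 x w) s) ->
  exists t, [/\ size t = size s, s = map (rotated e1 e2 x) (walk_from w t)
    & path manhattan_arc w (walk_from w t)].
Proof.
move=> mx; elim: s w => [|m s IH] w /=; first by exists [::].
case/andP => /diag_rotated[d ->] hs /andP[/eqP he ha].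
have [t [h1 h2 h3]] := IH _ hs ha.
exists (d :: t); rewrite /= h1 -h2 h3 andbT; split => //.
exact: arc_of_eta mx erefl erefl he.
Qed.

(* [e1] and [e2] are the signs by which the walk has to be reflected. *)
Definition decode (x : Z2) (e1 e2 : bool) (t : seq (bool * bool)) : seq Z2 :=
  map (rotated e1 e2 x) (trajectory t).

Lemma taxi_coding e x s : is_midpoint x -> path diag x s -> uniq (x :: s) ->
  all (pred1 e) (etas (x :: s)) -> turn_free (x :: s) ->
  exists e1 e2 t, [/\ size t = size s, taxi_walk (trajectory t) & x :: s = decode x e1 e2
    t].
Proof.
move=> mx hp hu he ht.
(* With these signs the steps of value [e] at the origin are the positive ones, as in the Manhattan
   lattice. *)
pose e1 := (sigma x == ~~ horizontal x) != e; pose e2 := sigma x != e.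
have x0 : x = rotated e1 e2 x 0.
  by clear; move: e1 e2 => e1 e2; case: x => u v; congr pair => /=; ring.
have := @rotated_path e x 0 s; rewrite -/e1 -/e2 /= -x0 => /(_ mx hp he) [t [h1 h2 h3]].
exists e1, e2, t.
have E : x :: s = decode x e1 e2 t by rewrite /decode /trajectory /= -x0 h2.
split => //; rewrite /taxi_walk /trajectory; apply/and3P; split => //.
  by move: hu; rewrite E => /map_uniq.
(* The factor is the determinant of the linear part of [rotated]. *)
apply/turn_freeP; move: ht; rewrite E; apply: (@turn_free_map _ (- (sg e1 * sg e2) *+ 2)).
  by clear; case: e1; case: e2.
by move=> a b c; rewrite /cross /rotated /=; ring.
Qed.

(* The Manhattan lattice seen from [u] is the reflection of the one seen from the
   origin in the axes prescribed by the parities of [u]. *)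
Definition renormalise (u : Z2) (d : bool * bool) : bool * bool :=
  flip_step (odd `|u.2|%N) (odd `|u.1|%N) d.

Definition endpoint (t : seq (bool * bool)) : Z2 := last 0 (walk_from 0 t).

Lemma walk_from_cat u t1 t2 :
  walk_from u (t1 ++ t2) = walk_from u t1 ++ walk_from (last u (walk_from u t1)) t2.
Proof. by elim: t1 u => //= d t1 IH u; rewrite IH. Qed.

Definition affine (u w : Z2) : Z2 := u + (sg (odd `|u.2|%N) * w.1, sg (odd `|u.1|%N) * w.2).

Lemma affine_add u w v :
  affine u (w + v) = affine u w + (sg (odd `|u.2|%N) * v.1, sg (odd `|u.1|%N) * v.2).
Proof. by congr pair => /=; ring. Qed.

Lemma sgK e (z : int) : sg e * (sg e * z) = z.
Proof. by case: e => /=; ring. Qed.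

Lemma affine_walk u w t :
  map (affine u) (walk_from w (map (renormalise u) t)) = walk_from (affine u w) t.
Proof.
elim: t w => //= d t IH w; rewrite affine_add /renormalise unit_step_flip !sgK
  -surjective_pairing.
congr (_ :: _); rewrite IH; congr walk_from.
by rewrite affine_add /= !sgK -surjective_pairing.
Qed.

Lemma affine_arc u w d : manhattan_arc (affine u w) (affine u (w + unit_step d)) ->
  manhattan_arc w (w + unit_step d).
Proof.
rewrite affine_add /manhattan_arc !(inj_eq (addrI _)) /orientation /=.
set p := odd `|u.2|%N; set q := odd `|u.1|%N.
have -> : odd `|(u.2 + sg q * w.2)%R|%N = p (+) odd `|w.2|%N.
  rewrite /p /sg; move: (u.2) (w.2) (q) => x y b; clear.
  by case E : (odd `|x|%N); case F : (odd `|y|%N); case: b; rewrite /= ?mul1r ?mulN1r;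
    move: E F; clear; lia.
have -> : odd `|(u.1 + sg p * w.1)%R|%N = q (+) odd `|w.1|%N.
  rewrite /q /sg; move: (u.1) (w.1) (p) => x y b; clear.
  by case E : (odd `|x|%N); case F : (odd `|y|%N); case: b; rewrite /= ?mul1r ?mulN1r;
    move: E F; clear; lia.
by case: d => [[] []]; case: p; case: q; case: (odd `|w.1|%N); case: (odd `|w.2|%N).
Qed.

Lemma taxi_prefix t1 t2 : taxi_walk (trajectory (t1 ++ t2)) -> taxi_walk (trajectory t1).
Proof.
rewrite /taxi_walk /trajectory -!/(walk_from _ _) walk_from_cat => /and4P[_ hp hu ht].
apply/and4P; split => //.
- by move: hp; rewrite cat_path => /andP[].
- by move: hu; rewrite -cat_cons cat_uniq => /andP[].
- apply/turn_freeP => r1 a b c d r2 E; move/turn_freeP: ht; apply.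
  by rewrite -cat_cons E -catA.
Qed.

Lemma taxi_suffix t1 t2 : taxi_walk (trajectory (t1 ++ t2)) ->
  taxi_walk (trajectory (map (renormalise (endpoint t1)) t2)).
Proof.
rewrite /taxi_walk /trajectory -!/(walk_from _ _) walk_from_cat => /and4P[_ hp hu ht].
set u := endpoint t1; have u0 : u = affine u 0.
  by rewrite /affine; case: u => x y; congr pair => /=; ring.
have E : u :: walk_from u t2 = map (affine u) (0 :: walk_from 0 (map (renormalise u) t2)).
  by rewrite /= affine_walk -u0.
have sfx : exists r, 0 :: walk_from 0 t1 ++ walk_from u t2 = r ++ u :: walk_from u t2.
  exists (belast 0 (walk_from 0 t1)).
  by rewrite -cat_rcons /u /endpoint -lastI cat_cons.
move: sfx => [r Er]; apply/and4P; split => //.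
- move: hp; rewrite cat_path => /andP[_]; rewrite -/(endpoint t1) -/u {1 2}u0 -affine_walk.
  elim: (t2) (0) => //= d t IH w /andP[h1 h2]; rewrite (affine_arc h1) /=; exact: IH.
- by move: hu; rewrite -/(endpoint t1) -/u Er cat_uniq E => /and3P[_ _ /map_uniq].
- apply/turn_freeP; apply: (@turn_free_map (affine u) (sg (odd `|u.2|%N) * sg (odd
  `|u.1|%N))).
  + by case: (odd _); case: (odd _).
  + by move=> a b c; rewrite /cross /affine /=; ring.
  + rewrite -E => r1 a b c d r2 E'; move/turn_freeP: ht; rewrite -/(endpoint t1) -/u Er.
    by apply; rewrite E' catA.
Qed.

Lemma flip_stepK e1 e2 : involutive (flip_step e1 e2).
Proof. by case=> [[] []]; case: e1; case: e2. Qed.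

(** Cutting after [m] steps is injective: the first part determines its endpoint, hence the
    reflection that recovers the second part. *)
Lemma taxi_count_submul m k : (taxi_count (m + k) <= taxi_count m * taxi_count k)%N.
Proof.
rewrite /taxi_count -cardsX; set A := [set s | _]; set B := [set s | _];
  set C := [set s | _].
pose d0 := (true, true).
pose g (s : seq (bool * bool)) := map (renormalise (endpoint (take m s))) (drop m s).
pose f (s : (m + k).-tuple (bool * bool)) : m.-tuple (bool * bool) * k.-tuple (bool *
  bool) :=
  (insubd (nseq_tuple m d0) (take m s), insubd (nseq_tuple k d0) (g s)).
have f1 s : tval (f s).1 = take m s.
  by rewrite -[LHS]/(val (f s).1) /f /= insubdK // unfold_in /= size_takel // size_tuple
    leq_addr.
have f2 s : tval (f s).2 = g s.
  by rewrite -[LHS]/(val (f s).2) /f /= insubdK // unfold_in /= size_map size_drop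
    size_tuple addKn.
have fi : injective f.
  move=> s s' E; apply: val_inj; have E1 : take m s = take m s' by rewrite -!f1 E.
  have E2 : g s = g s' by rewrite -!f2 E.
  change (tval s = tval s'); rewrite -(cat_take_drop m s) -(cat_take_drop m s') E1;
    congr cat.
  move: E2; rewrite /g E1; apply: inj_map; exact: inv_inj (flip_stepK _ _).
rewrite -(card_imset (mem A) fi); apply: subset_leq_card;
  apply/fintype.subsetP => _ /imsetP[s sA ->].
rewrite !inE f1 f2; move: sA; rewrite inE -{1}(cat_take_drop m s) => h.
by rewrite (taxi_prefix h) (taxi_suffix h).
Qed.

(** The straight walk along the positive x-axis is a taxi walk. *)
Lemma taxi_count_gt0 m : (0 < taxi_count m)%N.
Proof.
rewrite /taxi_count card_gt0; apply/set0Pn; exists (nseq_tuple m (false, true)).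
rewrite inE /= /taxi_walk /trajectory /=.
have E u : walk_from u (nseq m (false, true)) = [seq (u.1 + i.+1%:Z, u.2) | i <- iota 0 m].
  elim: m u => //= m IH [x y]; rewrite IH /=; congr (_ :: _).
    by congr pair => /=; rewrite ?addr0.
  rewrite -[1%N]/(1 + 0)%N iotaDl -map_comp; apply: eq_map => i /=.
  by congr pair; rewrite ?addr0 // -addrA; congr (_ + _); rewrite -PoszD.
have S : steps (0 :: walk_from 0 (nseq m (false, true))) = nseq m (1, 0).
  rewrite /=; elim: m (0 : Z2) {E} => //= m IH u.
  by rewrite IH; congr (_ :: _); rewrite addrAC subrr add0r.
apply/and3P; split.
- rewrite -/(walk_from 0 _); have : (0 : Z2).2 = 0 by [].
  elim: m (0 : Z2) {E S} => //= m IH u u0; rewrite /manhattan_arc u0 eqxx /= IH //.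
  by rewrite /= u0.
- have E' : 0 :: walk_from 0 (nseq m (false, true)) = [seq ((i%:Z,
  0) : Z2) | i <- iota 0 m.+1].
    rewrite E /=; congr (_ :: _); rewrite -[1%N]/(1 + 0)%N iotaDl -map_comp.
    by apply: eq_map => i /=; congr pair; rewrite add0r.
  change (uniq (0 :: walk_from 0 (nseq m (false, true)))).
  by rewrite E' map_inj_uniq ?iota_uniq // => i j [].
- rewrite /no_repeated_turn /turns -/(walk_from 0 _) S; case: m {E S} => //= m.
  have -> : pairmap cross (1, 0) (nseq m (1, 0)) = nseq m 0 by elim: m => //= m ->.
  by case: m => //= m; elim: m.
Qed.

(** * Growth of taxi walks *)

Lemma bernoulli (R : realDomainType) (x : R) m : 0 <= x -> 1 + m%:R * x <= (1 + x) ^+ m.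
Proof.
move=> x0; elim: m => [|m IH]; first by rewrite mul0r addr0 expr0.
rewrite exprS; apply: le_trans (ler_wpM2l _ IH); last by rewrite addr_ge0.
rewrite mulrDl mul1r mulrDr mulr1 -natr1 mulrDl mul1r -!addrA.
rewrite lerD2l lerD2l lerDl mulr_ge0 // mulr_ge0 //.
Qed.

(* Fekete's lemma: the limit exists and is the infimum. *)
Lemma submultiplicative_growth (R : realType) (c : nat -> R)
    (L := limn (fun m => c m `^ (m%:R^-1))) :
  (forall m, 1 <= c m) -> (forall m k, c (m + k)%N <= c m * c k) ->
  1 <= L /\ forall nu, L < nu -> exists2 C, 0 < C & forall m, c m <= C * nu ^+ m.
Proof.
move=> c1 cS; pose u m := c m `^ (m%:R^-1).
have u0 m : 0 <= u m by exact: powR_ge0.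
have uE m : (0 < m)%N -> u m ^+ m = c m.
  move=> m0; rewrite /u -powR_mulrn ?powR_ge0 // -powRrM mulVf ?pnatr_eq0 -?lt0n //.
  by rewrite powRr1 // (le_trans ler01).
have u1 m : (0 < m)%N -> 1 <= u m.
  move=> m0; rewrite leNgt; apply/negP => h; have := c1 m.
  by rewrite -(uE _ m0) leNgt exprn_ilt1 // -lt0n m0.
pose E := [set u k.+1 | k in [set: nat]]%classic; pose l := inf E.
have E0 : (E !=set0)%classic by exists (u 1%N); exists 0%N.
have lbE : lbound E 1 by move=> _ [k _ <-]; apply: u1.
have l1 : 1 <= l by apply: lb_le_inf.
have lu m : (0 < m)%N -> l <= u m.
  by case: m => // m _; apply: ge_inf; [exists 1 | exists m].
have bound nu : l < nu -> exists2 C, 0 < C & forall m, c m <= C * nu ^+ m.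
  move=> lnu; have nu1 : 1 <= nu := le_trans l1 (ltW lnu).
  have [_ [k _ <-]] : exists2 x, E x & x < l + (nu - l).
    by apply: inf_adherent; [rewrite subr_gt0|split => //; exists 1].
  rewrite addrC subrK => uk.
  have ck : c k.+1 <= nu ^+ k.+1.
    by rewrite -uE // lerXn2r // ?nnegrE ?u0 ?ltW // (le_lt_trans _ uk).
  (* [C] takes care of the remainder when [m] is divided by [k.+1]. *)
  pose C := \sum_(r < k.+1) c r.
  have cC r : (r < k.+1)%N -> c r <= C.
    move=> hr; rewrite /C (bigD1 (Ordinal hr)) //= lerDl sumr_ge0 // => i _.
    by rewrite (le_trans ler01).
  have C0 : 0 < C by apply: lt_le_trans (cC 0%N _) => //; apply: lt_le_trans (c1 _).
  exists C => // m.
  have H q r : (r < k.+1)%N -> c (q * k.+1 + r)%N <= C * nu ^+ (q * k.+1).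
    move=> hr; elim: q => [|q IH]; first by rewrite mul0n add0n expr0 mulr1 cC.
    rewrite mulSn -addnA; apply: le_trans (cS _ _) _.
    rewrite exprD mulrCA; apply: ler_pM => //; exact: le_trans ler01 (c1 _).
  rewrite {1}(divn_eq m k.+1); apply: le_trans (H _ _ (ltn_pmod _ _)) _ => //.
  rewrite ler_pM2l // ler_weXn2l //.
  by rewrite {2}(divn_eq m k.+1) leq_addr.
have cvg : (u @ \oo --> l)%classic.
  apply/cvgrPdist_le => e e0.
  have [C C0 hC] : exists2 C, 0 < C & forall m, c m <= C * (l + e / 2) ^+ m.
    by apply: bound; rewrite ltrDl divr_gt0.
  set nu := l + e / 2 in hC; have nu0 : 0 < nu.
    by rewrite /nu ltr_wpDl ?divr_gt0 // (le_trans ler01).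
  (* Passing from [nu] to [l + e] gains a factor [1 + x], whose powers eventually exceed [C] by
     Bernoulli's inequality. *)
  pose x := (e / 2) / nu; have x0 : 0 < x by rewrite !divr_gt0.
  have nuE : l + e = nu * (1 + x).
    by rewrite mulrDr mulr1 /x mulrC divfK ?gt_eqF // /nu -addrA -splitr.
  near=> m.
  have m0 : (0 < m)%N by near: m; exact: nbhs_infty_gt.
  rewrite distrC ger0_norm ?subr_ge0 ?lu // lerBlDl.
  have Cm : C <= (1 + x) ^+ m.
    apply: le_trans (bernoulli _ (ltW x0)); rewrite -lerBlDl -ler_pdivrMr //.
    by near: m; apply: nbhs_infty_ger.
  rewrite -(@ler_pXn2r _ m) // ?nnegrE ?u0 ?addr_ge0 ?(ltW e0) ?(le_trans ler01 l1) //.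
  rewrite uE // nuE exprMn (le_trans (hC m)) // mulrC ler_pM2l ?exprn_gt0 //.
have -> : L = l by apply: cvg_lim.
by split.
Unshelve. all: by end_near.
Qed.

Lemma mu_t_ge1 (R : realType) : 1 <= mu_t R.
Proof.
have [] := @submultiplicative_growth R (fun m => (taxi_count m)%:R) => //.
- by move=> m; rewrite ler1n taxi_count_gt0.
- by move=> m k; rewrite -natrM ler_nat taxi_count_submul.
Qed.

Lemma taxi_count_bound (R : realType) (nu : R) : mu_t R < nu ->
  exists2 C, 0 < C & forall m, (taxi_count m)%:R <= C * nu ^+ m.
Proof.
have [] := @submultiplicative_growth R (fun m => (taxi_count m)%:R).
- by move=> m; rewrite ler1n taxi_count_gt0.
- by move=> m k; rewrite -natrM ler_nat taxi_count_submul.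
by move=> _; apply.
Qed.

(** * The cut defined by a path *)

(** The centre of a face has two odd doubled coordinates; its four neighbours are the midpoints of
    the sides. *)
Definition face (f : Z2) : bool := odd `|f.1|%N && odd `|f.2|%N.

Definition inside (N : int) (m : Z2) : bool := (0 < m.1 < N) && (0 < m.2 < N).

Lemma face_shift4 v m : face (shift4 v m) = face m.
Proof.
by case: v m => [i j] [x y]; rewrite /face /shift4 /=; congr andb; clear; lia.
Qed.

(** Each neighbour of [b] on the path is a side of exactly one of the two faces at [b]; crossing the
    edge means passing from one face to the other. *)
Lemma face_crossing f a b c : face f -> is_midpoint a -> diag a b -> diag b c -> a != c ->
  z2_adj b f -> (eta a b == eta b c) = z2_adj a f (+) z2_adj c f.
Proof.
move=> hf ma; base_case a ma v a0 ha => h; diag_case h s1 => h; diag_case h s2.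
rewrite eq_shift4 => hac hbf.
have [u E] : exists u, f = shift4 v (a0 + diag_vec s1 + unit_step u).
  move: hbf; rewrite /z2_adj; move: (a0 + diag_vec s1) => w; case: f {hf} => [x y].
  rewrite /= => h; pose z := (w.1 + 4 * v.1); pose t := (w.2 + 4 * v.2).
  exists (z == x, (z < x) || (t < y)); rewrite /shift4 /unit_step /=.
  move: h; rewrite -/z -/t => h.
  have -> : x = z + (x - z) by ring. 
  have -> : y = t + (y - t) by ring.
  by case: eqP => hz; case: ifP => ht; congr pair; rewrite /z /t /= in h hz ht *;
    move: h hz ht; clear; lia.
subst f; have E x y : z2_adj (shift4 v x) (shift4 v y) = z2_adj x y.
  have S (i j l : int) : i + 4 * l - (j + 4 * l) = i - j by ring.
  by rewrite /z2_adj /shift4 /= !S.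
move: hf; rewrite !E !eta_shift4.
rewrite face_shift4.
move=> k2; move: hbf; rewrite E => _; apply: (elimT eqP); imp k2; imp hac.
dirs_case u; dirs_case s2; dirs_case s1; points_case a0 ha; by vm_compute.
Qed.

(** An edge on the bottom or top side borders only one face of the box. *)
Lemma boundary_face N f a b : in_box N a -> diag a b -> horizontal b ->
  b.2 = 0 \/ b.2 = N ->
  inside N f -> z2_adj b f -> z2_adj a f.
Proof.
case: a b f => [x y] [z w] [s t]; rewrite /in_box /inside /diag /z2_adj /is_midpoint /=.
by clear; lia.
Qed.

Lemma between_neighbours (N x y z : int) : 0 <= x <= N -> 0 <= z <= N ->
  `|y - x| == 1 -> `|z - y| == 1 -> x != z -> 0 < y < N.
Proof. by lia. Qed.

Lemma odd_inside (N y : int) : ~~ odd `|N|%N -> odd `|y|%N -> 0 <= y <= N -> 0 < y < N.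
Proof. by lia. Qed.

Lemma midpoint_odd2 m : is_midpoint m -> ~~ horizontal m -> odd `|m.2|%N.
Proof. by case: m => x y; rewrite /is_midpoint /horizontal /=; lia. Qed.

(** The neighbours lie on opposite sides of a crossed edge, so its transverse coordinate is strictly
    between theirs; the other coordinate is odd, while [N] is even. *)
Lemma crossing_inside N a b c : in_box N a -> in_box N b -> in_box N c -> ~~ odd `|N|%N ->
  diag a b -> diag b c -> eta a b == eta b c -> inside N b.
Proof.
move=> /and3P[ma a1 a2] /and3P[mb b1 b2] /and3P[_ c1 c2] hN dab dbc he.
have := eta_touch ma dab dbc; rewrite he.
case/andP: dab => dab1 dab2; case/andP: dbc => dbc1 dbc2; rewrite /inside.
case: ifP => hb /esym/negbT hac.
  by rewrite (odd_inside hN hb b1) (between_neighbours a2 c2 dab2 dbc2 hac).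
rewrite (between_neighbours a1 c1 dab1 dbc1 hac).
by rewrite (odd_inside hN (midpoint_odd2 mb (negbT hb)) b2).
Qed.

(* The midpoints of [b :: s] at which the path, arriving from [a], crosses the
   bisected edge. *)
Fixpoint crossings_from (a b : Z2) (s : seq Z2) : seq Z2 :=
  if s is c :: s' then
    if eta a b == eta b c then b :: crossings_from b c s' else crossings_from b c s'
  else [:: b].

(** The first midpoint counts as crossed, like the last: the path is thought of as leaving the grid
    there. *)
Definition crossings (p : seq Z2) : seq Z2 :=
  if p is a :: b :: s then a :: crossings_from a b s else p.

Lemma crossings_from_subseq a b s : subseq (crossings_from a b s) (b :: s).
Proof.
elim: s a b => [|c s IH] a b /=; first by rewrite eqxx.
case: ifP => _; first by rewrite eqxx; apply: IH.
exact: subseq_trans (IH b c) (subseq_cons _ _).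
Qed.

Lemma crossings_subseq p : subseq (crossings p) p.
Proof.
case: p => [|a [|b s]]; rewrite ?subseq_refl //.
exact: (@cat_subseq _ [:: a] _ [:: a] _ (subseq_refl _) (crossings_from_subseq a b s)).
Qed.

Lemma crossings_from_size a b s :
  (size (b :: s) <= size (crossings_from a b s) + changes (eta a b) (pairmap eta b s))%N.
Proof.
elim: s a b => [|c s IH] a b //=; have := IH b c; rewrite /=.
by case: (eta a b == eta b c) => /=; move: (size (crossings_from b c s)) (changes _ _) =>
  i j; clear; lia.
Qed.

Lemma crossings_size p : (size p <= size (crossings p) + alternation_count (etas p))%N.
Proof. by case: p => [|a [|b s]] //=; have := crossings_from_size a b s;
  rewrite /= addSn ltnS. Qed.


Lemma boundary_horizontal N m : ~~ odd `|N|%N -> is_midpoint m -> m.2 = 0 \/ m.2 = N ->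
  horizontal m.
Proof. by case: m => x y; rewrite /is_midpoint /horizontal /=; clear; lia. Qed.

(** The step from [a] to [b] runs in [f] when both are sides of [f]. Each crossing of a side enters
    or leaves [f], and the path finally leaves the grid, so an odd number of crossings is still to
    come exactly when it is in [f]. *)
Lemma crossings_from_parity N f a b s : ~~ odd `|N|%N -> face f -> inside N f ->
  path diag a (b :: s) -> all (in_box N) [:: a, b & s] -> uniq [:: a, b & s] ->
  (last b s).2 = 0 \/ (last b s).2 = N ->
  odd (count (z2_adj^~ f) (crossings_from a b s)) = z2_adj a f && z2_adj b f.
Proof.
move=> hN ff fi; elim: s a b => [|c s IH] a b.
  move=> /= /andP[dab _] /and3P[ba bb _] _ hl.
  have hb : horizontal b by apply: boundary_horizontal hN _ hl; case/and3P: bb.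
  rewrite addn0; case h : (z2_adj b f); rewrite ?andbF //=.
  by rewrite (boundary_face ba dab hb hl fi h).
move=> /= /and3P[dab dbc hs] /and4P[ba bb bc hall] hu hl.
have ma : is_midpoint a by case/and3P: ba.
have hbu : uniq [:: b, c & s] by case/andP: hu.
have ac : a != c by move: hu; rewrite !inE !negb_or => /andP[/and3P[]].
have {IH} := IH b c (introT andP (conj dbc hs)) (introT and3P (And3 bb bc hall)) hbu hl.
have := face_crossing ff ma dab dbc ac.
case E : (z2_adj b f) => h1 h2; last by case: ifP => _; rewrite /= ?E h2 andbF.
rewrite {}h1 // andbT; move: h2.
by case: (z2_adj a f); case: (z2_adj c f) => /= h2; rewrite ?E ?oddD h2.
Qed.

Lemma crossings_from_inside N a b s m : ~~ odd `|N|%N ->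
  path diag a (b :: s) -> all (in_box N) [:: a, b & s] ->
  m \in crossings_from a b s -> m = last b s \/ inside N m.
Proof.
move=> hN; elim: s a b => [|c s IH] a b /=; first by rewrite inE => _ _ /eqP; left.
move=> /and3P[dab dbc hs] /and4P[ba bb bc hall].
have {}IH : m \in crossings_from b c s -> m = last c s \/ inside N m.
  by apply: IH; rewrite /= ?dbc ?bb ?bc.
case: ifP => // he; rewrite inE => /orP[/eqP ->|//]; right.
exact: crossing_inside ba bb bc hN dab dbc he.
Qed.

(** Just before or just after crossing a side of [f] the path is in [f], so a neighbour on the path
    is another side of [f]. *)
Lemma crossings_from_neighbour N f a b s m : ~~ odd `|N|%N -> face f -> inside N f ->
  path diag a (b :: s) -> all (in_box N) [:: a, b & s] -> uniq [:: a, b & s] ->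
  (last b s).2 = 0 \/ (last b s).2 = N ->
  m \in crossings_from a b s -> z2_adj m f ->
  exists2 m', m' \in [:: a, b & s] & z2_adj m' f && diag m m'.
Proof.
move=> hN ff fi; elim: s a b => [|c s IH] a b.
  move=> /= /andP[dab _] /and3P[ba bb _] _ hl; rewrite inE => /eqP -> h.
  have hb : horizontal b by apply: boundary_horizontal hN _ hl; case/and3P: bb.
  by exists a; rewrite ?inE ?eqxx // (boundary_face ba dab hb hl fi h) diagC.
move=> /= /and3P[dab dbc hs] /and4P[ba bb bc hall] hu hl.
have ma : is_midpoint a by case/and3P: ba.
have hbu : uniq [:: b, c & s] by case/andP: hu.
have ac : a != c by move: hu; rewrite !inE !negb_or => /andP[/and3P[]].
have {}IH := IH b c (introT andP (conj dbc hs)) (introT and3P (And3 bb bc hall)) hbu hl.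
have IH' : m \in crossings_from b c s -> z2_adj m f ->
    exists2 m', m' \in [:: a, b, c & s] & z2_adj m' f && diag m m'.
  by move=> h1 h2; have [m' h3 h4] := IH h1 h2; exists m'; rewrite // in_cons h3 orbT.
case: ifP => // he; rewrite inE => /orP[/eqP ->|//] h.
have := face_crossing ff ma dab dbc ac h; rewrite he.
case ha : (z2_adj a f); first by exists a; rewrite ?inE ?eqxx // ha diagC.
by case hc : (z2_adj c f) => // _; exists c; rewrite ?inE ?eqxx ?orbT // hc.
Qed.

Lemma last_crossings_from a b s : last b s \in crossings_from a b s.
Proof.
elim: s a b => [|c s IH] a b /=; first by rewrite inE.
by case: ifP => _; rewrite ?inE IH ?orbT.
Qed.

(** * The height function *)

Definition hmid (x y : nat) : Z2 := ((x.*2.+1)%:Z, (y.*2)%:Z).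
Definition vmid (x y : nat) : Z2 := ((x.*2)%:Z, (y.*2.+1)%:Z).

(* The parity of the number of crossings on the way from the lower left corner along
   the bottom row and then upwards; since a path crosses the sides of each face an
   even number of times, any other way gives the same parity. *)
Definition height (X : pred Z2) (x y : nat) : bool :=
  odd (\sum_(0 <= i < x) X (hmid i 0) + \sum_(0 <= j < y) X (vmid x j))%N.

Lemma height_up X x y : height X x y.+1 = height X x y (+) X (vmid x y).
Proof. by rewrite /height big_nat_recr //= addnA oddD oddb. Qed.

(** Induction on the row: the face between two rows has an even number of crossed sides. *)
Lemma height_right (X : pred Z2) k x y :
  (forall x y, (x < k)%N -> (y < k)%N ->
     odd (X (hmid x y) + X (hmid x y.+1) + X (vmid x y) + X (vmid x.+1 y)) = false) ->
  (x < k)%N -> (y <= k)%N -> height X x.+1 y = height X x y (+) X (hmid x y).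
Proof.
move=> hX hx; elim: y => [|y IH] hy.
  by rewrite /height big_nat_recr //= !big_nil !addn0 oddD oddb.
rewrite !height_up (IH (ltnW hy)); have := hX x y hx hy.
rewrite !oddD !oddb; case: (height X x y); case: (X (hmid x y)); case: (X (hmid x y.+1));
by case: (X (vmid x y)); case: (X (vmid x.+1 y)).
Qed.

Lemma count_four (f : Z2) (s : seq Z2) : uniq s ->
  count (z2_adj^~ f) s = (((f - (0, 1))%R \in s) + ((f + (0, 1))%R \in s) +
     ((f - (1, 0))%R \in s) + ((f + (1, 0))%R \in s))%N.
Proof.
move=> us; pose l := [:: f - (0, 1); f + (0, 1); f - (1, 0); f + (1, 0)].
have ul : uniq l.
  by case: f @l => x y; rewrite /= !inE !negb_or -!pair_eqE /=; lia.
have E : (z2_adj^~ f) =1 mem l.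
  case=> u v; case: f @l ul => x y; rewrite /z2_adj /= !inE -!pair_eqE /= => _.
  by clear; lia.
rewrite (eq_count E) -size_filter (_ : size _ = size [seq x <- l | x \in s]).
  by rewrite size_filter /= !addnA addn0.
apply: perm_size; apply: uniq_perm; rewrite ?filter_uniq // => z.
by rewrite !mem_filter andbC.
Qed.

(** Ascents minus descents telescope to [g k - g 0]; the equation avoids subtraction. *)
Lemma row_crossings (g : nat -> bool) k :
  (\sum_(0 <= x < k) (g x.+1 (+) g x) + g k = (\sum_(0 <= x < k) (~~ g x &&
    g x.+1)).*2 + g 0)%N.
Proof.
elim: k => [|k IH]; first by rewrite !big_nil.
rewrite !big_nat_recr //= doubleD; move: IH.
by case: (g k); case: (g k.+1) => /=; lia.
Qed.

Lemma crossing_path_props (k : nat) p (N := k%:Z *+ 2) : (0 < k)%N -> crossing_path N p ->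
  let cr := crossings p in
  [/\ uniq cr, [/\ {subset cr <= p}, (size p <= size cr + 1)%N,
    head 0 p \in cr & last 0 p \in cr],
      forall f, face f -> inside N f -> odd (count (z2_adj^~ f) cr) = false,
      forall m, m \in cr -> m = head 0 p \/ m = last 0 p \/ inside N m
    & forall f m, face f -> inside N f -> m \in cr -> z2_adj m f ->
      exists2 m', m' \in p & z2_adj m' f && diag m m'].
Proof.
move=> k0 hp; have evenN : ~~ odd `|N|%N by rewrite /N; clear; lia.
have := crossing_path_size hp.
case: p hp => [|a [|b s]] // hp; first by rewrite /N /= => h; exfalso; move: k0 h; clear;
  lia.
move=> _ cr; have [h1 h2 h3 h4 h5] := and5P hp.
have subp : subseq cr [:: a, b & s] := crossings_subseq _.
have uc : uniq cr := subseq_uniq subp h2.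
have hl : (last b s).2 = 0 \/ (last b s).2 = N.
  by move: h4; rewrite /spans /= => /orP[/andP[_ /eqP]|/andP[_ /eqP]]; [left|right].
have ha : a.2 = 0 \/ a.2 = N.
  by move: h4; rewrite /spans /= => /orP[/andP[/eqP]|/andP[/eqP]]; [right|left].
have ba : in_box N a by case/andP: h3.
have bb : in_box N b by case/and3P: h3.
have hor : horizontal a by apply: boundary_horizontal evenN _ ha; case/and3P: ba.
have dba : diag b a by rewrite diagC; case/andP: h1.
split => //.
- split; first exact: mem_subseq.
  + by apply: leq_trans (crossings_size _) _; rewrite leq_add2l.
  + by rewrite inE eqxx.
  + by rewrite inE /= last_crossings_from orbT.
- move=> f ff fi; rewrite /cr /= oddD (crossings_from_parity evenN ff fi h1 h3 h2 hl) oddb.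
  case e : (z2_adj a f) => //=.
  by rewrite (boundary_face bb dba hor ha fi e).
- move=> m; rewrite inE => /orP[/eqP ->|]; first by left.
  by move=> /(crossings_from_inside evenN h1 h3) [->|]; right; [left|right].
- move=> f m ff fi; rewrite inE => /orP[/eqP -> h|].
    by exists b; rewrite ?inE ?eqxx ?orbT // (boundary_face bb dba hor ha fi h) diagC.
  exact: (crossings_from_neighbour evenN ff fi h1 h3 h2 hl).
Qed.

(** A diagonal step changes both parities, so horizontal and vertical edges alternate. *)
Lemma double_horizontal p : diag_path p -> all is_midpoint p ->
  (size p <= (count horizontal p).*2 + ~~ horizontal (head 0%R p))%N.
Proof.
case: p => // a s; elim: s a => [|b s IH] a /=; first by case: (horizontal a).
move=> /andP[dab hs] /and3P[ma mb hall]; have := IH b hs; rewrite /= mb => /(_ hall).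
have -> : horizontal a = ~~ horizontal b.
  by move: dab ma; case: a b {IH hs mb} => [x y] [z w];
    rewrite /diag /is_midpoint /horizontal /=; clear; lia.
by case: (horizontal b) => /=; clear; lia.
Qed.

(* [G] consists of the vertices with [h = 1] whose left neighbour has [h = 0].  Each
   row contains one more such ascent than descents, so the ascents are half of
   [n + S], where the number [S] of horizontal edges crossed is at least
   [size p / 2 - 1].  Two ascents above each other lie on a face which the path
   traverses from bottom to top, hence with a touch on one of its other two sides;
   discarding the two ascents next to the unique touch makes [G] independent. *)
Lemma cut_of_path (k : nat) p (n := k.+1) : (0 < k)%N -> crossing_path (k%:Z *+ 2) p ->
  exists (h : nat -> nat -> bool) (G : {set vertex n}),
    [/\ forall u v : vertex n, grid_adj u v -> h u.1 u.2 != h v.1 v.2 ->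
      pos u + pos v \in p,
        forall y, h 0%N y = false,
        forall v, v \in G -> [&& (0 < v.1)%N, h v.1 v.2 & ~~ h v.1.-1 v.2],
        independent G
      & (size p + n.*2 <= #|G|.*2.*2 + 10)%N].
Proof.
move=> k0 hp; have [] := crossing_path_props k0 hp;
  set cr := crossings p => uc [subp szp hd lst] par ins nei.
pose X : pred Z2 := fun m => m \in cr; pose h := height X.
have [h1 h2 h3 h4 h5] : [/\ diag_path p, uniq p, all (in_box (k%:Z *+ 2)) p,
  spans (k%:Z *+ 2) (head 0 p) (last 0 p) & (0 < size p)%N].
  by move: hp; rewrite crossing_pathE => /andP[/and5P[]].
have hdp := subp _ hd; have lstp := subp _ lst.
have endE m : m \in cr -> m.2 = 0 \/ m.2 = k%:Z *+ 2 \/ inside (k%:Z *+ 2) m.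
  move=> /ins; move: h4 => /orP[/andP[/eqP e1 /eqP e2]|/andP[/eqP e1 /eqP e2]]
    [->|[->|]]; rewrite ?e1 ?e2; tauto.
have hright x y : (x < k)%N -> (y <= k)%N -> h x.+1 y = h x y (+) X (hmid x y).
  apply: height_right => {}x {}y hx hy; pose f : Z2 := ((x.*2.+1)%:Z, (y.*2.+1)%:Z).
  have ff : face f by rewrite /face /=; clear; lia.
  have fi : inside (k%:Z *+ 2) f by rewrite /inside /=; move: hx hy; clear; lia.
  have := par f ff fi; rewrite count_four // /X.
  have -> : f - (0, 1) = hmid x y by congr pair => /=; clear; lia.
  have -> : f + (0, 1) = hmid x y.+1 by congr pair => /=; clear; lia.
  have -> : f - (1, 0) = vmid x y by congr pair => /=; clear; lia.
  by have -> : f + (1, 0) = vmid x.+1 y by congr pair => /=; clear; lia.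
have novert x j : (x == 0%N) || (x == k) -> X (vmid x j) = false.
  move=> hx; apply/negP => /endE; rewrite /vmid /inside /=.
  by move: hx; clear; lia.
have h0 y : h 0%N y = false.
  by rewrite /h /height big_geq // add0n big1 // => j _; rewrite novert.
(* Exactly one crossed edge, at an end of the path, lies in the bottom row. As no edge of the right
   column is crossed, [h] is 1 on that column. *)
have [i0 i0k Xi0] : exists2 i0, (i0 < k)%N & forall i, X (hmid i 0) = (i == i0).
  have [m0 [m0p m0c m02 m0E]] : exists m0, [/\ m0 \in p, m0 \in cr, m0.2 = 0 &
     forall m, m \in cr -> m.2 = 0 -> m = m0].
    have kz : 0 <> k%:Z *+ 2 by move: k0; clear; lia.
    move: h4 => /orP[/andP[/eqP e1 /eqP e2]|/andP[/eqP e1 /eqP e2]];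
      [exists (last 0 p)|exists (head 0 p)]; split => // m mc m2;
      case: (ins m mc) => [E|[E|E]] //; exfalso.
    - by apply: kz; rewrite -e1 -m2 E.
    - by move: E; rewrite /inside m2 ltxx andbF.
    - by apply: kz; rewrite -e2 -m2 E.
    - by move: E; rewrite /inside m2 ltxx andbF.
  have [i0 i0k m0h] : exists2 i0, (i0 < k)%N & m0 = hmid i0 0.
    move: (allP h3 _ m0p) m02; case: (m0) => x y; rewrite /in_box /is_midpoint /= => bx y0.
    exists (`|(x %/ 2)%Z|%N); first by move: bx y0; clear; lia.
    by rewrite /hmid; congr pair; move: bx y0; clear; lia.
  exists i0 => // i; apply/idP/eqP => [hi|->]; last by rewrite -m0h.
  have : hmid i 0 = m0 by apply: m0E.
  by rewrite m0h => -[]; clear; lia.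
have hk y : h k y.
  rewrite /h /height [X in (_ + X)%N]big1 ?addn0 => [|j _];
    last by rewrite novert // eqxx orbT.
  rewrite big_mkord (bigD1 (Ordinal i0k)) //= Xi0 eqxx big1 // => i.
  by rewrite -val_eqE /= Xi0 => /negbTE ->.
(* At most one midpoint of the path is not crossed; [t] is that touch, or 0, which is no midpoint,
   if there is none. *)
have [t ht] : exists t, forall m, m \in p -> m \notin cr -> m = t.
  have : (size [seq m <- p | m \notin cr] <= 1)%N.
    have e1 : (size cr <= size [seq m <- p | m \in cr])%N.
      by apply: uniq_leq_size uc _ => m mc; rewrite mem_filter mc subp.
    have e2 : (size [seq m <- p | m \in cr] + size [seq m <- p | m \notin cr])%N = size p.
      by rewrite !size_filter; exact: (count_predC (mem cr) p).
    by rewrite -(leq_add2l (size cr)); apply: (leq_trans _ szp); rewrite -e2 leq_add2r.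
  case E : [seq m <- p | m \notin cr] => [|t [|]] // _.
    exists 0 => m mp mc; have : m \in [seq m <- p | m \notin cr] by rewrite mem_filter mc.
    by rewrite E.
  exists t => m mp mc; have : m \in [seq m <- p | m \notin cr] by rewrite mem_filter mc.
  by rewrite E inE => /eqP.
pose G0 : {set vertex n} := [set v : vertex n | [&& (0 < v.1)%N,
  h v.1 v.2 & ~~ h v.1.-1 v.2]].
pose G : {set vertex n} := [set v : vertex n | (v \in G0) && ((vmid v.1 v.2 != t) &&
  (vmid v.1.-1 v.2 != t))].
exists h, G; split => //.
- move=> u v; rewrite /grid_adj /z2_adj /= => huv hne.
  have X_p m : X m -> m \in p by apply: subp.
  have [hu1 hu2 hv1 hv2] := And4 (ltn_ord u.1) (ltn_ord u.2) (ltn_ord v.1) (ltn_ord v.2).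
  have [[a b]|[[a b]|[[a b]|[a b]]]] :
     (v.1 = u.1.+1 :> nat /\ v.2 = u.2 :> nat) \/ (u.1 = v.1.+1 :> nat /\
       v.2 = u.2 :> nat) \/
     (v.2 = u.2.+1 :> nat /\ v.1 = u.1 :> nat) \/ (u.2 = v.2.+1 :> nat /\ v.1 = u.1 :> nat).
    by move: huv; clear; lia.
  + have -> : pos u + pos v = hmid u.1 u.2 by rewrite /pos /hmid a b; congr pair => /=;
    clear; lia.
    have xk : (u.1 < k)%N by move: hv1; rewrite a.
    apply: X_p; move: hne; rewrite a b (hright _ _ xk hu2).
    by case: (h _ _); case: (X _).
  + have -> : pos u + pos v = hmid v.1 u.2 by rewrite /pos /hmid a b; congr pair => /=;
    clear; lia.
    have xk : (v.1 < k)%N by move: hu1; rewrite a.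
    apply: X_p; move: hne; rewrite a b (hright _ _ xk hu2).
    by case: (h _ _); case: (X _).
  + have -> : pos u + pos v = vmid u.1 u.2 by rewrite /pos /vmid a b; congr pair => /=;
    clear; lia.
    apply: X_p; move: hne; rewrite a b /h height_up.
    by case: (height _ _ _); case: (X _).
  + have -> : pos u + pos v = vmid u.1 v.2 by rewrite /pos /vmid a b; congr pair => /=;
    clear; lia.
    apply: X_p; move: hne; rewrite a b /h height_up.
    by case: (height _ _ _); case: (X _).
- by move=> v; rewrite !inE => /andP[].
- apply/forall_inP => u uG; apply/forall_inP => v vG; apply/negP => huv.
  wlog : u v uG vG huv / (v.1 = u.1.+1 :> nat /\
    v.2 = u.2 :> nat) \/ (v.2 = u.2.+1 :> nat /\ v.1 = u.1 :> nat).
    move=> W; have [H|H] : ((v.1 = u.1.+1 :> nat /\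
      v.2 = u.2 :> nat) \/ (v.2 = u.2.+1 :> nat /\ v.1 = u.1 :> nat)) \/
       ((u.1 = v.1.+1 :> nat /\ u.2 = v.2 :> nat) \/ (u.2 = v.2.+1 :> nat /\
         u.1 = v.1 :> nat)).
      by move: huv; rewrite /grid_adj /z2_adj /=; clear; lia.
    + exact: W H.
    + apply: W H => //; move: huv; rewrite /grid_adj /z2_adj /=.
      by rewrite (distrC (pos u).1) (distrC (pos u).2).
  move: uG vG; rewrite !inE => /andP[/and3P[u0 hu hu'] /andP[tu tu']] /andP[/and3P[v0 hv
    hv'] _].
  case=> [[a b]|[a b]]; first by move: hv'; rewrite a b hu.
  case E : (nat_of_ord u.1) u0 => [//|x] _; rewrite E /= in hu hu' tu tu' a b *.
  set y := nat_of_ord u.2 in a hu hu' tu tu'.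
  rewrite a b /= in hv hv'.
  have xk : (x < k)%N by have := ltn_ord u.1; rewrite E.
  have yk : (y < k)%N by have := ltn_ord v.2; rewrite a.
  pose f : Z2 := ((x.*2.+1)%:Z, (y.*2.+1)%:Z).
  have ff : face f by rewrite /face /=; clear; lia.
  have fi : inside (k%:Z *+ 2) f by rewrite /inside /=; move: xk yk; clear; lia.
  (* In the face between the two ascents the bottom side is crossed, the left and right ones are
     not. Yet a neighbour of the bottom side on the path is one of these two, hence the touch [t],
     which [G] avoids. *)
  have bot : X (hmid x y) by move: hu hu'; rewrite (hright x y xk (ltnW yk));
    case: (h x y); case: (X _).
  have left_side : ~~ X (vmid x y) by move: hv' hu'; rewrite /h height_up;
    case: (height _ _ _); case: (X _).
  have right_side : ~~ X (vmid x.+1 y) by move: hv hu; rewrite /h height_up;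
    case: (height _ _ _); case: (X _).
  have adj : z2_adj (hmid x y) f by rewrite /z2_adj /=; clear; lia.
  have [m' m'p /andP[mf dm]] := nei f _ ff fi bot adj.
  have [E'|E'] : m' = vmid x y \/ m' = vmid x.+1 y.
    have : m' == vmid x y \/ m' == vmid x.+1 y.
      move: mf dm; case: (m') => i j; rewrite /z2_adj /diag /vmid -!pair_eqE /=; clear; lia.
    by case=> /eqP ->; [left|right].
  + by move: tu'; rewrite -(ht m' m'p) ?E' ?eqxx //.
  + by move: tu; rewrite -(ht m' m'p) ?E' ?eqxx //.
pose S := (\sum_(0 <= y < n) \sum_(0 <= x < k) X (hmid x y))%N.
pose B := (\sum_(0 <= y < n) \sum_(0 <= x < k) (~~ h x y && h x.+1 y))%N.
have SB : (S + n = B.*2)%N.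
  rewrite /S /B -[X in (_ + X)%N]muln1 -{2}[n]subn0 -sum_nat_const_nat -big_split /=
    -muln2 big_distrl /=.
  apply: eq_big_nat => y /andP[_ yn]; rewrite muln2.
  have := row_crossings (h^~ y) k; rewrite h0 hk addn0 => <-; congr (_ + _)%N.
  by apply: eq_big_nat => x /andP[_ xk]; rewrite hright //; case: (h x y); case: (X _).
(* At least half of the midpoints are horizontal, and all of these except possibly [t] are
   crossed. *)
have pS : (size p <= S.*2 + 2)%N.
  have : (count horizontal p <= S + 1)%N.
    pose cells := [seq hmid x y | y <- index_iota 0 n, x <- index_iota 0 k].
    have -> : S = size [seq m <- cells | m \in cr].
      rewrite size_filter -sum1_count big_mkcond /cells big_allpairs_dep /=.
      by apply: eq_bigr => y _; apply: eq_bigr => x _; rewrite /X; case: (_ \in _).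
    rewrite -size_filter addn1 -[(size _).+1]/(size (t :: [seq m <- cells | m \in cr])).
    apply: uniq_leq_size; first exact: filter_uniq.
    move=> m; rewrite mem_filter inE mem_filter => /andP[hm mp].
    case mc : (m \in cr); last by rewrite (ht m mp) ?mc ?eqxx.
    apply/orP; right; rewrite /=; apply/allpairsP.
    move: (allP h3 _ mp) hm; case: (m) => i j;
      rewrite /in_box /is_midpoint /horizontal /= => bx hi.
    exists (`|(j %/ 2)%Z|%N, `|(i %/ 2)%Z|%N); rewrite !mem_index_iota /=; split.
    - by move: bx hi; clear; lia.
    - by move: bx hi; clear; lia.
    - by rewrite /hmid; congr pair; move: bx hi; clear; lia.
  have am : all is_midpoint p by apply: sub_all h3 => m /and3P[].
  have := double_horizontal h1 am.
  have -> : horizontal (head 0 p).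
    move: (allP h3 _ hdp) h4; case: (head 0 p) => i j; case: (last 0 p) => i' j'.
    by rewrite /in_box /is_midpoint /horizontal /spans /=; clear; lia.
  by rewrite addn0 => a b; apply: (leq_trans a); rewrite -(doubleD _ 1) leq_double.
have G0B : #|G0| = B.
  have -> : #|G0| = (\sum_(x < n) \sum_(y < n) ((x, y) \in G0))%N.
    rewrite pair_bigA -sum1_card big_mkcond; apply: eq_bigr => [[x y] _] /=.
    by case: (_ \in _).
  rewrite exchange_big /B big_mkord; apply: eq_bigr => y _.
  rewrite big_ord_recl inE /= add0n big_mkord; apply: eq_bigr => x _.
  by rewrite inE /= /bump /= add1n /= andbC.
pose A1 := [set v : vertex n | vmid v.1 v.2 == t].
pose A2 := [set v : vertex n | (0 < v.1)%N && (vmid v.1.-1 v.2 == t)].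
have A1_le : (#|A1| <= 1)%N.
  apply/card_le1_eqP => [[a b]] [c d]; rewrite !inE /vmid /= => /eqP <- /eqP [] => e1 e2.
  by congr pair; apply: val_inj => /=; move: e1 e2; clear; lia.
have A2_le : (#|A2| <= 1)%N.
  apply/card_le1_eqP => [[a b]] [c d]; rewrite !inE /vmid /= =>
    /andP[a0 /eqP <-] /andP[c0 /eqP []] => e1 e2.
  by congr pair; apply: val_inj => /=; move: a0 c0 e1 e2; clear; lia.
have : (#|G0| <= #|G| + (#|A1| + #|A2|))%N.
  apply: leq_trans (_ : #|G :|: (A1 :|: A2)| <= _)%N.
    apply: subset_leq_card; apply/fintype.subsetP => v vG0; rewrite !inE.
    have v0 : (0 < v.1)%N by move: vG0; rewrite inE => /andP[].
    move: vG0; rewrite inE => ->; rewrite v0.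
    by case: (vmid v.1 v.2 == t); case: (vmid v.1.-1 v.2 == t).
  apply: leq_trans (leq_card_setU _ _).1 _; rewrite leq_add2l.
  exact: (leq_card_setU _ _).1.
(* Since [#|G0| <= #|G| + 2], one has [size p + 2n <= 4 #|G0| + 2 <= 4 #|G| + 10]. *)
move: SB pS A1_le A2_le; rewrite G0B; move: #|G| #|A1| #|A2| (size p) => g g1 g2 l.
by clear; lia.
Qed.

(** * The shift *)

Lemma ler_sum_injection (R : numDomainType) (I J : finType) (P : pred I) (Q : pred J)
    (f : I -> J) (F : I -> R) (G : J -> R) :
  {in P &, injective f} -> (forall i, P i -> Q (f i) /\ F i <= G (f i)) ->
  (forall j, Q j -> 0 <= G j) -> \sum_(i | P i) F i <= \sum_(j | Q j) G j.
Proof.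
move=> fi fP G0; pose D := [set i | P i].
have -> : \sum_(i | P i) F i = \sum_(i in D) F i by apply: eq_bigl => i; rewrite inE.
apply: (@le_trans _ _ (\sum_(i in D) G (f i))).
  by apply: ler_sum => i; rewrite inE => /fP[].
have fi' : {in D &, injective f} by move=> i j; rewrite !inE; apply: fi.
rewrite -(big_imset G fi').
rewrite [leRHS](bigID [in f @: D]) /= -[leLHS]addr0; apply: lerD.
  rewrite le_eqVlt; apply/orP; left; apply/eqP; apply: eq_bigl => j.
  case E : (j \in _); rewrite ?andbF ?andbT //.
  by move/imsetP: E => [i]; rewrite inE => /fP[h _] ->.
by apply: sumr_ge0 => j /andP[/G0].
Qed.

Lemma ler_sum_subsets (R : numDomainType) (T : finType) (lambda : R) (A : {set T}) :
  0 <= lambda -> (1 + lambda) ^+ #|A| <= \sum_(S : {set T} | S \subset A) lambda ^+ #|S|.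
Proof.
move=> l0; have [m] := ubnP #|A|; elim: m A => // m IH A; rewrite ltnS => hA.
have [->|[x xA]] := set_0Vmem A.
  rewrite cards0 expr0 (bigD1 finset.set0) ?finset.sub0set //= cards0 expr0 lerDl.
  by apply: sumr_ge0 => S _; rewrite exprn_ge0.
have cA := cardsD1 x A; rewrite xA /= in cA.
have IHx := IH (A :\ x) (leq_trans _ hA); rewrite cA exprS mulrDl mul1r.
rewrite (bigID (fun S : {set T} => x \in S)) /= [leLHS]addrC; apply: lerD.
- apply: (@le_trans _ _ (\sum_(S : {set T} | S \subset A :\ x) lambda * lambda ^+ #|S|)).
    by rewrite -big_distrr /=; apply: ler_wpM2l => //; apply: IHx; rewrite cA.
  apply: (@ler_sum_injection _ _ _ _ _ (fun S => x |: S)).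
  + move=> S S'; rewrite -!topredE /= !subsetD1 => /andP[_ xS] /andP[_ xS'] E.
    by rewrite -(finset.setU1K xS) -(finset.setU1K xS') E.
  + move=> S; rewrite subsetD1 => /andP[SA xS];
    rewrite finset.subUset finset.sub1set xA SA finset.setU11.
    by rewrite cardsU1 xS exprS.
  + by move=> S _; rewrite exprn_ge0.
- apply: (le_trans (IHx _)); first by rewrite cA.
  apply: (@ler_sum_injection _ _ _ _ _ id) => //.
  + by move=> S; rewrite subsetD1 => /andP[-> ->].
  + by move=> S _; rewrite exprn_ge0.
Qed.

(** * Independent sets of a path *)

Definition path_independent n (K : {set 'I_n}) : bool :=
  [forall i in K, forall j in K, (nat_of_ord j != i.+1)%N].

Lemma path_independentP n (K : {set 'I_n}) :
  reflect (forall i j : 'I_n, i \in K -> j \in K ->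
    nat_of_ord j != i.+1) (path_independent K).
Proof.
apply: (iffP forall_inP) => h i; first by move=> j iK jK; move/forall_inP: (h i iK); apply.
by move=> iK; apply/forall_inP => j; apply: h.
Qed.

(* [r] is the Perron eigenvalue of the recursion [W m.+2 = W m.+1 + lambda * W m]. *)
Lemma path_partition_function (R : realFieldType) n (lambda r : R) :
  0 <= lambda -> 1 <= r -> r ^+ 2 = r + lambda ->
  \sum_(K : {set 'I_n} | path_independent K) lambda ^+ #|K| <= r ^+ n.+1.
Proof.
move=> l0 r1 rE.
pose Q m (K : {set 'I_n}) := path_independent K && [forall i in K, (i < m)%N].
pose W m := \sum_(K | Q m K) lambda ^+ #|K|.
have W0 : W 0%N <= 1.
  rewrite /W (bigD1 finset.set0) /=; last first.
    by apply/andP; split; [apply/path_independentP => i j|apply/forall_inP => i];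
      rewrite inE.
  rewrite cards0 expr0 big1 ?addr0 // => K /andP[/andP[_ /forall_inP hK]] /set0Pn[i /hK].
  by rewrite ltn0.
(* If the vertex [m] belongs to the set, then [m.-1] does not, and the other elements are below
   [m.-1]. *)
have WS m : (m < n)%N -> W m.+1 <= W m + lambda * W m.-1.
  move=> mn; rewrite /W (bigID (fun K : {set 'I_n} => Ordinal mn \in K)) /= [leLHS]addrC;
    apply: lerD.
    apply: (@ler_sum_injection _ _ _ _ _ id) => //; last by move=> K _; rewrite exprn_ge0.
    move=> K /andP[/andP[h1 /forall_inP h2] h3]; split => //; rewrite /Q h1 /=.
    apply/forall_inP => i iK; have := h2 i iK; rewrite ltnS leq_eqVlt => /orP[/eqP e|//].
    by move: h3; rewrite (_ : Ordinal mn = i) ?iK //; apply: val_inj.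
  rewrite big_distrr /=; apply: (@ler_sum_injection _ _ _ _ _ (fun K => K :\ Ordinal mn)).
  - move=> K K' /andP[_ k1] /andP[_ k2] E.
    by rewrite -(finset.setD1K k1) -(finset.setD1K k2) E.
  - move=> K /andP[/andP[/path_independentP h1 /forall_inP h2] h3]; split; last first.
      by rewrite (cardsD1 (Ordinal mn) K) h3 exprS.
    apply/andP; split.
      by apply/path_independentP => i j; rewrite !inE => /andP[_ iK] /andP[_ jK]; apply: h1.
    apply/forall_inP => i; rewrite !inE -val_eqE /= => /andP[im iK].
    have := h1 i (Ordinal mn) iK h3; have := h2 i iK; move: im => /=; clear; lia.
  - by move=> K _; rewrite mulr_ge0 ?exprn_ge0.
have r0 : 0 <= r by apply: le_trans r1.
have W1 : (0 < n)%N -> W 1%N <= r ^+ 2.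
  move=> n0; apply: (le_trans (WS _ n0)); rewrite rE; apply: lerD.
    exact: le_trans W0 r1.
  by rewrite ler_piMr.
have main m : (m.+1 <= n)%N -> W m <= r ^+ m.+1 /\ W m.+1 <= r ^+ m.+2.
  elim: m => [|m IH] hm; first by split; [apply: le_trans W0 _|apply: W1].
  have [h1 h2] := IH (ltnW hm); split => //; apply: (le_trans (WS _ hm)).
  rewrite (exprS r m.+2) (exprS r m.+1) mulrA -expr2 rE mulrDl -exprS.
  by apply: lerD => //; apply: ler_wpM2l.
have -> : \sum_(K : {set 'I_n} | path_independent K) lambda ^+ #|K| = W n.
  apply: eq_bigl => K; rewrite /Q andb_idr // => _.
  by apply/forall_inP => i _; apply: ltn_ord.
case: n Q W W0 WS W1 main => [|n] Q W W0 WS W1 main; first by apply: (le_trans W0);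
  rewrite expr1.
by have [] := main n (leqnn _).
Qed.

(** * Shifting an independent set across the cut *)

Definition left_of k (v : vertex k.+1) : vertex k.+1 := (inord v.1.-1, v.2).
Definition right_of k (v : vertex k.+1) : vertex k.+1 := (inord v.1.+1, v.2).

Lemma left_ofE k (v : vertex k.+1) : (left_of v).1 = v.1.-1 :> nat.
Proof. by rewrite /= inordK // (leq_ltn_trans (leq_pred _)). Qed.

Lemma right_ofE k (v : vertex k.+1) : (v.1 < k)%N -> (right_of v).1 = v.1.+1 :> nat.
Proof. by move=> hv; rewrite /= inordK. Qed.

Lemma right_ofK k (v : vertex k.+1) : (v.1 < k)%N -> left_of (right_of v) = v.
Proof.
case: v => [a b] /= ak; rewrite /left_of /right_of /= inordK //=.
by rewrite inord_val.
Qed.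

Lemma left_ofK k (v : vertex k.+1) : (0 < v.1)%N -> right_of (left_of v) = v.
Proof.
case: v => [a b] /= a0; rewrite /left_of /right_of /= inordK.
  by rewrite prednK // inord_val.
by rewrite (leq_ltn_trans (leq_pred _)).
Qed.

Lemma grid_adjE n (u v : vertex n) : grid_adj u v =
  [|| (v.1 == u.1.+1 :> nat) && (v.2 == u.2 :> nat), (u.1 == v.1.+1 :> nat) &&
    (v.2 == u.2 :> nat),
      (v.2 == u.2.+1 :> nat) && (v.1 == u.1 :> nat) | (u.2 == v.2.+1 :> nat) &&
        (v.1 == u.1 :> nat)].
Proof. by rewrite /grid_adj /z2_adj /=; lia. Qed.

Lemma grid_adjC n (u v : vertex n) : grid_adj u v = grid_adj v u.
Proof. by rewrite /grid_adj /z2_adj (distrC (pos u).1) (distrC (pos u).2). Qed.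

Definition separated k (h : nat -> nat -> bool) (I : {set vertex k.+1}) :=
  forall u v : vertex k.+1, grid_adj u v -> h u.1 u.2 != h v.1 v.2 -> u \notin I.

(* The part of [I] in [h = 1] moves one step to the right and [S] fills vacated
   places; what leaves the grid is recorded by [lost_column]. *)
Definition shifted k (h : nat -> nat -> bool) (I S : {set vertex k.+1}) : {set vertex
  k.+1} :=
  [set w : vertex k.+1 | if ~~ h w.1 w.2 then w \in I
     else if w.1 == 0%N :> nat then false
     else if h w.1.-1 w.2 then left_of w \in I else w \in S].

Definition lost_column k (h : nat -> nat -> bool) (I : {set vertex k.+1}) : {set 'I_k.+1} :=
  [set y : 'I_k.+1 | ((ord_max, y) \in I) && h k y].

Lemma independentP n (I : {set vertex n}) :
  reflect (forall u v : vertex n, u \in I -> v \in I -> grid_adj u v ->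
    False) (independent I).
Proof.
apply: (iffP forall_inP) => H u; first by move=> v uI vI;
  move/forall_inP: (H u uI) => /(_ v vI) /negP.
by move=> uI; apply/forall_inP => v vI; apply/negP; apply: H.
Qed.

(** Across the cut, the vertex with [h = 0] would be in [I], against [separated]. Two adjacent
    vertices with [h = 1] are pulled back to their left neighbours: if both have [h = 1], [I] is
    independent; if just one has, it contradicts [separated]; if none has, [S] is independent. *)
Lemma shifted_independent k h (I S : {set vertex k.+1}) :
  independent I -> separated h I -> independent S ->
  independent (shifted h I S).
Proof.
move=> /independentP iI sI /independentP iS; apply/independentP => u v.
wlog H : u v / ((v.1 = u.1.+1 :> nat) /\ (v.2 = u.2 :> nat)) \/ ((v.2 = u.2.+1 :> nat) /\
  (v.1 = u.1 :> nat)).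
  move=> W uJ vJ huv; have : (((v.1 = u.1.+1 :> nat) /\
    (v.2 = u.2 :> nat)) \/ ((v.2 = u.2.+1 :> nat) /\ (v.1 = u.1 :> nat))) \/
    (((u.1 = v.1.+1 :> nat) /\ (u.2 = v.2 :> nat)) \/ ((u.2 = v.2.+1 :> nat) /\
      (u.1 = v.1 :> nat))).
    by move: huv; rewrite grid_adjE; clear; lia.
  case=> H; first exact: W H uJ vJ huv.
  by apply: W H vJ uJ _; rewrite grid_adjC.
move=> uJ vJ huv; move: (uJ) (vJ); rewrite !inE.
case hu : (h u.1 u.2); case hv : (h v.1 v.2) => /=; last first.
- by move=> uI vI; apply: iI huv.
- by move=> uI _; move: uI; rewrite (negbTE (sI u v huv _)) // hu hv.
- by move=> _ vI; move: vI; rewrite (negbTE (sI v u _ _)) // ?hu ?hv // grid_adjC.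
case: eqP => // /eqP; rewrite -lt0n => u0; case: eqP => // /eqP; rewrite -lt0n => v0.
have adjl (w : vertex k.+1) : (0 < w.1)%N -> grid_adj (left_of w) w.
  by move=> w0; rewrite grid_adjE left_ofE prednK // !eqxx.
case: H => [[a b]|[a b]].
  have E : left_of v = u.
    move: a b; rewrite /left_of; case: (u) (v) => [u1 u2] [v1 v2] /= -> b.
    by rewrite inord_val; congr pair; apply: val_inj.
  rewrite E a /= b hu => + uI.
  case hl : (h _ _); first by move=> lI; apply: iI lI uI (adjl _ u0).
  by move: uI; rewrite (negbTE (sI u (left_of u) _ _)) ?left_ofE ?hu ?hl // grid_adjC adjl.
have adj2 : grid_adj (left_of u) (left_of v).
  by rewrite grid_adjE !left_ofE a b /= !eqxx /= ?orbT.
case hlu : (h u.1.-1 u.2); case hlv : (h v.1.-1 v.2).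
- by move=> x y; apply: iI x y adj2.
- move=> lI _; move: lI; rewrite (negbTE (sI _ _ adj2 _)) // !left_ofE /= hlu hlv //.
- move=> _ lI; move: lI; rewrite (negbTE (sI (left_of v) (left_of u) _ _)) //;
  first by rewrite grid_adjC.
  by rewrite !left_ofE /= hlu hlv.
- by move=> x y; apply: iS x y huv.
Qed.

Lemma lost_column_independent k h (I : {set vertex k.+1}) :
  independent I -> path_independent (lost_column h I).
Proof.
move=> /independentP iI; apply/path_independentP => i j;
  rewrite !inE => /andP[iK _] /andP[jK _].
by apply/eqP => E; apply: iI iK jK _; rewrite grid_adjE /= E !eqxx ?orbT.
Qed.

(** The part of [I] with [h = 0] stays, the part with [h = 1] outside the last column moves
    bijectively, and the rest is the lost column. All else in the shifted set is [S]. *)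
Lemma shifted_card k h (I S : {set vertex k.+1}) : (forall y, h 0%N y = false) ->
  separated h I ->
  (forall v : vertex k.+1, v \in S -> [&& (0 < v.1)%N, h v.1 v.2 & ~~ h v.1.-1 v.2]) ->
  (#|I| + #|S| = #|shifted h I S| + #|lost_column h I|)%N.
Proof.
move=> h0 sI hS; pose H := [set v : vertex k.+1 | h v.1 v.2].
pose M := [set v : vertex k.+1 | (v.1 < k)%N].
pose D := [set v : vertex k.+1 | (0 < v.1)%N && h v.1.-1 v.2].
set J := shifted h I S; set K := lost_column h I.
rewrite -(cardsID H I) -(cardsID H J) -(cardsID M (I :&: H)) -(cardsID D (J :&: H)).
have -> : #|J :\: H| = #|I :\: H|.
  by apply: eq_card => v; rewrite !inE; case: (h v.1 v.2).
have -> : #|(J :&: H) :\: D| = #|S|.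
  apply: eq_card => v; rewrite !inE; apply/idP/idP; last first.
    move=> vS; have /and3P[v0 hv hl] := hS v vS.
    by rewrite hv (negbTE hl) (gtn_eqF v0) vS andbF.
  case/andP; case hv : (h v.1 v.2); rewrite ?andbF //= andbT.
  case: eqP => // /eqP; rewrite -lt0n => -> /=.
  by case: (h _ _).
have -> : #|(I :&: H) :\: M| = #|K|.
  have inj : injective (fun y : 'I_k.+1 => (ord_max, y) : vertex k.+1) by move=> x y [].
  rewrite -(card_imset _ inj); apply: eq_card => -[a b]; rewrite !inE -leqNgt /=.
  apply/idP/imsetP => [/and3P[ka abI hab]|[y yK [-> ->]]].
    have E : a = ord_max by apply: val_inj; apply/eqP; rewrite eqn_leq ka -ltnS ltn_ord.
    by move: abI hab; rewrite E => abI hab; exists b => //; rewrite inE abI.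
  by move: yK; rewrite inE /= leqnn.
have -> : #|(J :&: H) :&: D| = #|(I :&: H) :&: M|.
  have inj : {in (I :&: H) :&: M &, injective (@right_of k)}.
    move=> u v; rewrite !inE => /andP[_ uk] /andP[_ vk] E.
    by rewrite -(right_ofK uk) E right_ofK.
  rewrite -(card_in_imset inj); apply: eq_card => v; rewrite !inE.
  apply/idP/imsetP => [|[u]]; last first.
    rewrite !inE => /andP[/andP[uI hu] uk] ->.
    have adj : grid_adj u (right_of u) by rewrite grid_adjE right_ofE // !eqxx.
    have hr : h (right_of u).1 (right_of u).2.
      apply/negPn/negP => hr; move: uI; rewrite (negbTE (sI _ _ adj _)) //.
      by rewrite hu (negbTE hr).
    rewrite hr; rewrite right_ofE // right_ofK //= uI.
    by rewrite hu.
  case hv : (h v.1 v.2); rewrite ?andbF //= andbT => /and3P[].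
  case: eqP => // /eqP; rewrite -lt0n => v0 + _ hl; rewrite hl => lI.
  exists (left_of v); last by rewrite left_ofK.
  by rewrite !inE lI left_ofE hl /= -ltnS prednK.
by ring.
Qed.

(** A vertex of [I] with [h = 1] is read off at its right neighbour or in the lost column; if the
    right neighbour has [h = 0], the vertex is unoccupied by [separated]. *)
Lemma shifted_inj k h (I I' S S' : {set vertex k.+1}) :
  separated h I -> separated h I' ->
  (forall v : vertex k.+1, v \in S -> [&& (0 < v.1)%N, h v.1 v.2 & ~~ h v.1.-1 v.2]) ->
  (forall v : vertex k.+1, v \in S' -> [&& (0 < v.1)%N, h v.1 v.2 & ~~ h v.1.-1 v.2]) ->
  shifted h I S = shifted h I' S' -> lost_column h I = lost_column h I' -> I = I' /\ S = S'.
Proof.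
move=> sI sI' hS hS' /setP EJ /setP EK; split; apply/setP => v.
  case hv : (h v.1 v.2); last by have := EJ v; rewrite !inE hv.
  have [vk|kv] := ltnP v.1 k; last first.
    have E : v.1 = ord_max by apply: val_inj; apply/eqP; rewrite eqn_leq kv -ltnS ltn_ord.
    have hk : h k v.2 by move: hv; rewrite E.
    by have := EK v.2; rewrite !inE hk !andbT -E -surjective_pairing.
  have adj : grid_adj v (right_of v) by rewrite grid_adjE right_ofE // !eqxx.
  case hr : (h (right_of v).1 (right_of v).2).
    by have := EJ (right_of v); rewrite !inE hr right_ofE // right_ofK //= hv.
  by rewrite (negbTE (sI _ _ adj _)) ?(negbTE (sI' _ _ adj _)) // hv hr.
have K (T J : {set vertex k.+1}) : (forall v : vertex k.+1, v \in T ->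
  [&& (0 < v.1)%N, h v.1 v.2 & ~~ h v.1.-1 v.2]) ->
   (v \in T) = (v \in shifted h J T) && [&& (0 < v.1)%N, h v.1 v.2 & ~~ h v.1.-1 v.2].
  move=> hT; apply/idP/idP => [vT|].
    have /and3P[v0 hv hl] := hT v vT.
    by rewrite inE hv (negbTE hl) (gtn_eqF v0) vT v0.
  by case/and4P => + v0 hv hl; rewrite inE hv (negbTE hl) (gtn_eqF v0).
by rewrite (K S I hS) (K S' I' hS') EJ.
Qed.

(** Sending [(I, S)] with [S] in [G] to the shifted set and the lost column is injective and
    preserves weights; the sum over [S] supplies the power of [1 + lambda]. *)
Lemma shift_bound (R : realFieldType) k (lambda : R) (h : nat -> nat ->
  bool) (G : {set vertex k.+1}) (Q : pred {set vertex k.+1}) :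
  0 <= lambda -> (forall y, h 0%N y = false) ->
  (forall v : vertex k.+1, v \in G -> [&& (0 < v.1)%N, h v.1 v.2 & ~~ h v.1.-1 v.2]) ->
  independent G -> (forall I, Q I -> independent I /\ separated h I) ->
  (\sum_(I | Q I) lambda ^+ #|I|) * (1 + lambda) ^+ #|G| <=
  (\sum_(I : {set vertex k.+1} | independent I) lambda ^+ #|I|) *
  \sum_(K : {set 'I_k.+1} | path_independent K) lambda ^+ #|K|.
Proof.
move=> l0 h0 hG /independentP iG hQ.
apply: (@le_trans _ _ ((\sum_(I | Q I) lambda ^+ #|I|) *
    \sum_(S : {set vertex k.+1} | S \subset G) lambda ^+ #|S|)).
  by rewrite ler_wpM2l ?ler_sum_subsets // sumr_ge0 // => I _; rewrite exprn_ge0.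
rewrite !big_distrlr /= !pair_big /=.
apply: (@ler_sum_injection _ _ _ _ _ (fun z => (shifted h z.1 z.2, lost_column h z.1))).
- move=> [I S] [I' S'] /andP[/hQ[_ s1] /fintype.subsetP t1] /andP[/hQ[_ s2]
  /fintype.subsetP t2] [e1 e2].
  have [] := shifted_inj s1 s2 _ _ e1 e2; last by rewrite /= => -> ->.
    by move=> v /t1; apply: hG.
  by move=> v /t2; apply: hG.
- move=> [I S] /= /andP[/hQ[iI sI] /fintype.subsetP sS].
  have hS (v : vertex k.+1) : v \in S -> [&& (0 < v.1)%N, h v.1 v.2 & ~~ h v.1.-1 v.2].
    by move=> /sS; apply: hG.
  have iS : independent S by apply/independentP => u v /sS uG /sS vG; apply: iG.
  rewrite shifted_independent // lost_column_independent //; split => //.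
  by rewrite -!exprD (shifted_card h0 sI hS).
- by move=> [I S] _; rewrite mulr_ge0 ?exprn_ge0.
Qed.

(** * Summation over paths *)

(** The midpoint determines the edge, so [u] is one of its unoccupied endpoints. *)
Lemma unoccupied_separated n (I : {set vertex n}) (u v : vertex n) :
  grid_adj u v -> unoccupied_edge I (pos u + pos v) -> u \notin I.
Proof.
move=> huv /existsP[u' /existsP[v' /and3P[/andP[huv' /eqP E] iu iv]]].
have e1 : (u.1 + v.1 = u'.1 + v'.1)%N by have := congr1 fst E; rewrite /=; clear; lia.
have e2 : (u.2 + v.2 = u'.2 + v'.2)%N by have := congr1 snd E; rewrite /=; clear; lia.
move: huv huv'; rewrite !grid_adjE => huv huv'.
suff : u = u' \/ u = v' by case=> ->.
have : ((u.1 == u'.1 :> nat) && (u.2 == u'.2 :> nat)) || ((u.1 == v'.1 :> nat) &&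
  (u.2 == v'.2 :> nat)).
  move: e1 e2 huv huv'; move: (u.1 : nat) (u.2 : nat) (v.1 : nat) (v.2 : nat) => a b a1 b1.
  move: (u'.1 : nat) (u'.2 : nat) (v'.1 : nat) (v'.2 : nat) => a2 b2 a3 b3; clear.
  move=> e1 e2 /or4P[] /andP[/eqP x1 /eqP x2] /or4P[] /andP[/eqP x3 /eqP x4]; lia.
case: u u' v' {E e1 e2 huv huv' iu iv} => [a b] [a' b'] [a'' b''] /=.
by case/orP => /andP[/eqP x /eqP y]; [left|right]; congr pair; apply: val_inj.
Qed.

Lemma flip_setK n : involutive (@flip_set n).
Proof. by move=> I; apply/setP => -[a b]; rewrite !inE. Qed.

Lemma card_flip_set n (I : {set vertex n}) : #|flip_set I| = #|I|.
Proof.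
have inj : injective (fun v : vertex n => (v.2, v.1)) by move=> [a b] [c d] [-> ->].
rewrite -(card_imset (mem I) inj); apply: eq_card => -[a b]; rewrite !inE.
apply/idP/imsetP => [h|[[c d] h [-> ->]] //]; by exists (b, a).
Qed.

Lemma independent_flip_set n (I : {set vertex n}) : independent (flip_set I) =
  independent I.
Proof.
have H (J : {set vertex n}) : independent J -> independent (flip_set J).
  move=> /independentP h; apply/independentP => u v; rewrite !inE => uJ vJ huv.
  by apply: h uJ vJ _; move: huv; rewrite !grid_adjE /= => /or4P[] /andP[-> ->];
    rewrite ?orbT.
by apply/idP/idP => /H //; rewrite flip_setK.
Qed.

(** The fourth root [q] of [1 + lambda] turns the lower bound on [4 #|G|] into an inequality between
    natural powers. *)
Lemma path_weight (R : realFieldType) k (lambda r q : R) p (n := k.+1) :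
  0 <= lambda -> 1 <= r -> r ^+ 2 = r + lambda -> 1 <= q -> q ^+ 4 = 1 + lambda ->
  (0 < k)%N -> crossing_path (k%:Z *+ 2) p ->
  (\sum_(I : {set vertex n} | independent I && all (unoccupied_edge I) p) lambda ^+ #|I|)
    * q ^+ (size p + n.*2) <=
  (\sum_(I : {set vertex n} | independent I) lambda ^+ #|I|) * r ^+ n.+1 * q ^+ 10.
Proof.
move=> l0 r1 rE q1 qE k0 hp; have q0 : 0 <= q by apply: le_trans q1.
have [h [G [h1 h2 h3 h4 h5]]] := cut_of_path k0 hp.
have hQ (I : {set vertex n}) : independent I && all (unoccupied_edge I) p ->
    independent I /\ separated h I.
  case/andP => iI oI; split => // u v adj huv.
  exact: unoccupied_separated adj (allP oI _ (h1 u v adj huv)).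
have sge0 (P : pred {set vertex n}) : 0 <= \sum_(I | P I) lambda ^+ #|I|.
  by apply: sumr_ge0 => I _; rewrite exprn_ge0.
have := shift_bound l0 h2 h3 h4 hQ; rewrite -/n => hb.
apply: (@le_trans _ _ ((\sum_(I : {set vertex n} | independent I &&
  all (unoccupied_edge I) p)
    lambda ^+ #|I|) * ((1 + lambda) ^+ #|G| * q ^+ 10))).
  apply: ler_wpM2l => //; rewrite -qE -exprM -exprD; apply: ler_weXn2l => //.
  by apply: (leq_trans h5); rewrite leq_add2r; clear; lia.
rewrite mulrA; apply: ler_wpM2r; first by rewrite exprn_ge0.
apply: (le_trans hb); apply: ler_wpM2l => //.
exact: path_partition_function.
Qed.


Definition box_point m (b : 'I_m * 'I_m) : Z2 := ((b.1 : nat)%:Z, (b.2 : nat)%:Z).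

(* A path [q1 ++ t :: q2] is coded by the starting points of [q1], [t] and [q2], two
   pairs of signs, and two taxi walks. *)
Notation code m k1 k2 :=
  ((('I_m * 'I_m) * ('I_m * 'I_m) * ('I_m * 'I_m)) * ((bool * bool) * (bool * bool)) *
   (k1.-tuple (bool * bool) * k2.-tuple (bool * bool)))%type.

Definition decode_path m k1 k2 (c : code m k1 k2) : seq Z2 :=
  decode (box_point c.1.1.1.1) c.1.2.1.1 c.1.2.1.2 c.2.1 ++
  box_point c.1.1.1.2 :: decode (box_point c.1.1.2) c.1.2.2.1 c.1.2.2.2 c.2.2.

Definition taxi_code m k1 k2 (c : code m k1 k2) : bool :=
  taxi_walk (trajectory c.2.1) && taxi_walk (trajectory c.2.2).

Lemma size_decode x e1 e2 t : size (decode x e1 e2 t) = (size t).+1.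
Proof. by rewrite size_map /= size_scanl. Qed.

Lemma size_decode_path m k1 k2 (c : code m k1 k2) : size (decode_path c) = (k1 + k2 + 3)%N.
Proof. by rewrite size_cat -cat1s size_cat !size_decode !size_tuple; clear; rewrite /=;
  lia. Qed.

Lemma card_taxi_code m k1 k2 :
  #|[set c : code m k1 k2 | taxi_code c]| = (m ^ 6 * 16 * (taxi_count k1 * taxi_count
    k2))%N.
Proof.
rewrite (_ : [set c | _] = finset.setX [set: _] (finset.setX
   [set s : k1.-tuple (bool * bool) | taxi_walk (trajectory s)]
   [set s : k2.-tuple (bool * bool) | taxi_walk (trajectory s)])); last first.
  by apply/setP => -[a [b c]]; rewrite !inE.
rewrite !cardsX -/(taxi_count k1) -/(taxi_count k2); congr (_ * _)%N.
by rewrite cardsT !card_prod !card_ord card_bool; ring.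
Qed.

Lemma box_pointP m (x : Z2) : 0 <= x.1 < m%:Z -> 0 <= x.2 < m%:Z ->
  exists b : 'I_m * 'I_m, box_point b = x.
Proof.
case: x => x y /= hx hy.
have hx' : (`|x|%N < m)%N by move: hx; clear; lia.
have hy' : (`|y|%N < m)%N by move: hy; clear; lia.
by exists (Ordinal hx', Ordinal hy'); congr pair => /=; move: hx hy; clear; lia.
Qed.

Lemma in_box_point k (x : Z2) (m := (k.+1).*2) :
  in_box (k%:Z *+ 2) x -> exists b : 'I_m * 'I_m, box_point b = x.
Proof.
by case: x => x y; rewrite /in_box => /and3P[_ h1 h2]; apply: box_pointP;
  move: h1 h2; rewrite /m /=; clear; lia.
Qed.

Lemma crossing_path_pos k p : crossing_path (k%:Z *+ 2) p -> (0 < k)%N.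
Proof.
case: p => // -[x y] s /and5P[_ _ /andP[+ _] _ _]; rewrite /in_box /is_midpoint /=.
by clear; lia.
Qed.

Lemma crossing_path_max k p (m := (k.+1).*2) : crossing_path (k%:Z *+ 2) p ->
  (size p <= m ^ 2)%N.
Proof.
rewrite crossing_pathE => /andP[/and5P[_ up bp _ _] _].
have -> : (m ^ 2)%N = size [seq box_point b | b : 'I_m * 'I_m].
  by rewrite size_map -cardE card_prod !card_ord.
apply: uniq_leq_size => // x /(allP bp) /in_box_point[b <-].
by apply: map_f; rewrite mem_enum.
Qed.

Lemma fault_line_code k (I : {set vertex k.+1}) p (m := (k.+1).*2) : fault_line I p ->
  exists k1 k2 (c : code m k1 k2), [/\ taxi_code c,
    crossing_path (k%:Z *+ 2) (decode_path c),
    (k1 < m ^ 2)%N /\ (k2 < m ^ 2)%N &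
    all (unoccupied_edge I) (decode_path c) || all (unoccupied_edge (flip_set I))
      (decode_path c)].
Proof.
move=> /fault_line_crossing[q [hq ho]].
have EN : side_length k.+1 = k%:Z *+ 2 by rewrite /side_length; clear; lia.
rewrite EN in hq.
have [U [hU hI]] : exists U : pred Z2, all U q /\
  (U = unoccupied_edge I \/ U = unoccupied_edge (flip_set I)).
  case: ho => ho; [exists (unoccupied_edge I) | exists (unoccupied_edge (flip_set I))].
    by split => //; left.
  by split => //; right.
have [q1 [t [q2 [e1 [e2 [h1 h2 h3 h4 [h5 h6]]]]]]] := crossing_path_decomposition hq hU.
have hmax := crossing_path_max h1.
have [d u b] : [/\ diag_path (q1 ++ t :: q2), uniq (q1 ++ t :: q2) & all (in_box (k%:Z *+
  2)) (q1 ++ t :: q2)].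
  by move: h1; rewrite crossing_pathE => /andP[/and5P[]].
case: q1 q2 h3 h4 h5 h6 h1 h2 hmax d u b => [|x1 s1] [|x2 s2] // _ /andP[m1 m2] t1 t2 h1
  h2 hmax d u b.
move: d; rewrite diag_path_cat => /andP[d1 /andP[_ d2]].
move: b; rewrite all_cat => /andP[b1 /andP[bt b2]].
move: u; rewrite cat_uniq => /and3P[u1 _ /andP[_ u2]].
have {}d1 : path diag x1 s1 by move: d1; rewrite /= -cats1 cat_path => /andP[].
have c1 : in_box (k%:Z *+ 2) x1 by case/andP: b1.
have c2 : in_box (k%:Z *+ 2) x2 by case/andP: b2.
have mx1 : is_midpoint x1 by case/and3P: c1.
have mx2 : is_midpoint x2 by case/and3P: c2.
have [f1 [f2 [w1 [sz1 tx1 E1]]]] := taxi_coding mx1 d1 u1 m1 t1.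
have [f3 [f4 [w2 [sz2 tx2 E2]]]] := taxi_coding mx2 d2 u2 m2 t2.
have [[B1 P1] [Bt Pt] [B2 P2]] := And3 (in_box_point c1) (in_box_point bt) (in_box_point
  c2).
pose c : code m (size w1) (size w2) := ((B1, Bt, B2), ((f1, f2), (f3, f4)), (in_tuple w1,
  in_tuple w2)).
have Ec : decode_path c = (x1 :: s1) ++ t :: x2 :: s2 by rewrite E1 E2 /decode_path /= P1
  Pt P2.
exists (size w1), (size w2), c; rewrite Ec; split => //.
- by apply/andP; split.
- move: hmax; rewrite size_cat /= sz1 sz2 -/m; move: (m ^ 2)%N (size s1) (size s2) => i j l.
  by clear; lia.
- by case: hI h2 => -> ->; rewrite ?orbT.
Qed.

Lemma ler_sum_single (R : numDomainType) (T : finType) (P : pred T) (F : T -> R) i :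
  P i -> (forall j, P j -> 0 <= F j) -> F i <= \sum_(j | P j) F j.
Proof.
by move=> Pi F0; rewrite (bigD1 i) //= lerDl sumr_ge0 // => j /andP[/F0].
Qed.

(** A union bound over the codes; the factor 2 accounts for [I] and [flip_set I], which have equal
    weight. *)
Lemma fault_sum_le (R : realFieldType) k (lambda : R) (n := k.+1) (m :=
  n.*2) : 0 <= lambda ->
  \sum_(I in fault_sets n) lambda ^+ #|I| <=
  \sum_(k1 < m ^ 2) \sum_(k2 < m ^ 2)
    \sum_(c : code m k1 k2 | taxi_code c && crossing_path (k%:Z *+ 2) (decode_path c))
      (\sum_(I : {set vertex n} | independent I && all (unoccupied_edge I) (decode_path c))
         lambda ^+ #|I|) *+ 2.
Proof.
move=> l0; pose w (I : {set vertex n}) : R := lambda ^+ #|I|.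
have w0 I : 0 <= w I by rewrite exprn_ge0.
pose U (s : seq Z2) (I : {set vertex n}) := all (unoccupied_edge I) s.
pose f (s : seq Z2) (I : {set vertex n}) : R :=
  (if U s I then w I else 0) + (if U s (flip_set I) then w I else 0).
have f0 s I : 0 <= f s I by rewrite /f addr_ge0 //; case: ifP.
have fE s : \sum_(I : {set vertex n} | independent I) f s I =
    (\sum_(I : {set vertex n} | independent I && U s I) w I) *+ 2.
  rewrite big_split /= -!big_mkcondr mulr2n; congr (_ + _).
  rewrite (reindex_inj (inv_inj (@flip_setK n))) /=.
  apply: eq_big => [I|I _]; first by rewrite independent_flip_set flip_setK.
  by rewrite /w card_flip_set.
rewrite [leRHS](_ : _ = \sum_(I : {set vertex n} | independent I) \sum_(k1 < m ^ 2)
  \sum_(k2 < m ^ 2)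
    \sum_(c : code m k1 k2 | taxi_code c && crossing_path (k%:Z *+ 2) (decode_path c)) f
      (decode_path c) I); last first.
  rewrite [RHS]exchange_big; apply: eq_bigr => k1 _.
  rewrite [RHS]exchange_big; apply: eq_bigr => k2 _.
  by rewrite [RHS]exchange_big; apply: eq_bigr => c _; exact/esym/fE.
apply: (@ler_sum_injection _ _ _ _ _ id) => //; last first.
  by move=> I _; do 3![apply: sumr_ge0 => ? _].
move=> I; rewrite inE => /andP[iI /asboolP[p /fault_line_code[k1 [k2 [c [h1 h2 [h3 h4]
  h5]]]]]].
split => //; have fI : w I <= f (decode_path c) I.
  by rewrite /f; case/orP: h5 => h5; rewrite /U h5 ?lerDl ?lerDr; case: ifP.
apply: (le_trans fI).
pose i1 : 'I_(m ^ 2) := Ordinal h3; pose i2 : 'I_(m ^ 2) := Ordinal h4.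
have s3 (j1 j2 : 'I_(m ^ 2)) : 0 <= \sum_(c : code m j1 j2 | taxi_code c &&
  crossing_path (k%:Z *+ 2) (decode_path c)) f (decode_path c) I.
  exact: sumr_ge0.
apply: (le_trans _ (ler_sum_single (i := i1) _ _)) => //; last by move=> j _;
  apply: sumr_ge0.
apply: (le_trans _ (ler_sum_single (i := i2) _ _)) => //.
by apply: (ler_sum_single (i := c)) => //; rewrite h1.
Qed.

(** As [nu / q <= 1] and [l >= 2n - 1], the power [(nu / q) ^+ l] is at most
    [(q / nu) * (nu / q) ^+ (2n)], where [q / nu <= q]. *)
Lemma weight_exponent (R : realFieldType) (nu q r : R) n l : 1 <= nu -> nu <= q -> 0 <= r ->
  (n.*2 <= l.+1)%N ->
  nu ^+ l * (r ^+ n.+1 * q ^+ 10) <= r * q ^+ 11 * (r * nu ^+ 2 / q ^+ 4) ^+ n * q ^+ (l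
    + n.*2).
Proof.
move=> nu1 nuq r0 hl.
have nu0 : 0 < nu by apply: lt_le_trans nu1.
have q0 : 0 < q by apply: lt_le_trans nuq.
have -> : r * q ^+ 11 * (r * nu ^+ 2 / q ^+ 4) ^+ n * q ^+ (l + n.*2) =
    (r ^+ n.+1 * q ^+ 10) * (q * (nu / q) ^+ n.*2 * q ^+ l).
  have dbl (x : R) : x ^+ n.*2 = (x ^+ 2) ^+ n by rewrite -exprM mul2n.
  rewrite exprD !dbl expr_div_n (_ : q ^+ 4 = q ^+ 2 * q ^+ 2) -?exprD //.
  rewrite exprD !expr_div_n !exprMn (exprS r n) (exprS q 10).
  by field; rewrite expf_neq0 ?gt_eqF.
rewrite mulrC; apply: ler_wpM2l; first by rewrite mulr_ge0 ?exprn_ge0 // ltW.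
have -> : nu ^+ l = (nu / q) ^+ l * q ^+ l by rewrite -exprMn divfK ?gt_eqF.
apply: ler_wpM2r; first by rewrite exprn_ge0 // ltW.
have x0 : 0 <= nu / q by rewrite divr_ge0 // ltW.
have x1 : nu / q <= 1 by rewrite ler_pdivrMr // mul1r.
have : (nu / q) ^+ l.+1 <= (nu / q) ^+ n.*2 by apply: ler_wiXn2l.
rewrite exprS => h; rewrite -ler_pdivrMl //; apply: le_trans h.
by apply: ler_wpM2r; rewrite ?exprn_ge0 // ler_pdivlMr // mulVf ?gt_eqF.
Qed.

Lemma fault_sum_bound (R : realFieldType) k (lambda r q nu C : R) (n := k.+1) :
  0 <= lambda -> 1 <= r -> r ^+ 2 = r + lambda -> q ^+ 4 = 1 + lambda ->
  1 <= nu -> nu <= q -> 0 < C -> (forall m, (taxi_count m)%:R <= C * nu ^+ m) ->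
  \sum_(I in fault_sets n) lambda ^+ #|I| <=
  (32 * C ^+ 2 * r * q ^+ 11) * 2 ^+ 10 * n%:R ^+ 10 * (r * nu ^+ 2 / q ^+ 4) ^+ n *
  \sum_(I : {set vertex n} | independent I) lambda ^+ #|I|.
Proof.
move=> l0 r1 rE qE nu1 nuq C0 hC.
have q1 : 1 <= q := le_trans nu1 nuq; have q0 : 0 < q by apply: lt_le_trans q1.
have r0 : 0 <= r by apply: le_trans r1.
have nu0 : 0 <= nu by apply: le_trans nu1.
apply: (le_trans (fault_sum_le _ l0)); rewrite -/n.
set Z := \sum_(I : {set vertex n} | independent I) lambda ^+ #|I|.
set m := n.*2; set th := r * nu ^+ 2 / q ^+ 4.
have Z0 : 0 <= Z by apply: sumr_ge0 => I _; rewrite exprn_ge0.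
have th0 : 0 <= th by rewrite divr_ge0 ?mulr_ge0 ?exprn_ge0 // ltW.
(* Three starting points give [m ^ 6], the four signs give 16, and the reflection doubles. The two
   lengths below [m ^ 2] raise the degree to 10. *)
pose B := 32 * C ^+ 2 * r * q ^+ 11 * m%:R ^+ 6 * th ^+ n * Z.
have q0' := ltW q0; have C0' := ltW C0.
have B0 : 0 <= B by rewrite /B; do ![apply: mulr_ge0 => //]; rewrite ?exprn_ge0 ?ler0n.
apply: (@le_trans _ _ (\sum_(k1 < m ^ 2) \sum_(k2 < m ^ 2) B)); last first.
  rewrite !sumr_const !card_ord -[leLHS]mulr_natl -[B *+ _]mulr_natl !natrX /B.
  have -> : m%:R = 2 * n%:R :> R by rewrite /m -mul2n natrM.
  by rewrite le_eqVlt; apply/orP; left; apply/eqP; ring.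
apply: ler_sum => k1 _; apply: ler_sum => k2 _.
set l := (k1 + k2 + 3)%N.
(* Smaller lengths do not occur: a crossing path has at least [2n - 1] midpoints. *)
have [hl|hl] := leqP n.*2 l.+1; last first.
  rewrite big1 // => c /andP[_ /crossing_path_size]; rewrite size_decode_path => h.
  by exfalso; move: h hl; rewrite /l /n; clear; lia.
pose T := r * q ^+ 11 * th ^+ n / nu ^+ l * Z.
have nul : 0 < nu ^+ l by rewrite exprn_gt0 // (lt_le_trans _ nu1).
have T0 : 0 <= T.
  by rewrite /T; do ![apply: mulr_ge0 => //]; rewrite ?exprn_ge0 ?invr_ge0 // ltW.
apply: (@le_trans _ _ (\sum_(c : code m k1 k2 | taxi_code c) T *+ 2)).
  rewrite [leLHS]big_mkcondr; apply: ler_sum => c hc; case: ifP => hp;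
    last by rewrite mulrn_wge0.
  rewrite lerMn2r; apply/orP; right.
  have := path_weight l0 r1 rE q1 qE (crossing_path_pos hp) hp.
  rewrite size_decode_path -/l -/n -/Z; set W := \sum_(I : {set vertex n} | _ && _) _ => hW.
  have qq : 0 < q ^+ (l + n.*2) by rewrite exprn_gt0.
  rewrite -(ler_pM2r qq); apply: (le_trans hW).
  have hw : r ^+ n.+1 * q ^+ 10 <= r * q ^+ 11 * th ^+ n / nu ^+ l * q ^+ (l + n.*2).
    by rewrite [leRHS]mulrAC ler_pdivlMr // [leLHS]mulrC; apply: weight_exponent.
  by rewrite -[leLHS]mulrA [leLHS]mulrC /T [leRHS]mulrAC; apply: ler_wpM2r.
rewrite (eq_bigl (fun c => c \in [set c : code m k1 k2 | taxi_code c]));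
  last by move=> c; rewrite inE.
rewrite sumr_const card_taxi_code -[leLHS]mulr_natl -[T *+ 2]mulr_natl.
rewrite (natrM _ (m ^ 6 * 16)) (natrM _ (m ^ 6)) natrX (natrM _ (taxi_count k1)).
have hk : (taxi_count k1)%:R * (taxi_count k2)%:R <= C ^+ 2 * nu ^+ l.
  apply: (@le_trans _ _ (C * nu ^+ k1 * (C * nu ^+ k2))); first by apply: ler_pM.
  rewrite mulrACA -expr2 -exprD; apply: ler_wpM2l; first by rewrite exprn_ge0 // ltW.
  by apply: ler_weXn2l; rewrite // /l leq_addr.
apply: (@le_trans _ _ (m%:R ^+ 6 * 16 * (C ^+ 2 * nu ^+ l) * (2 * T))).
  by apply: ler_wpM2r; [rewrite mulr_ge0|apply: ler_wpM2l => //;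
    rewrite mulr_ge0 ?exprn_ge0].
rewrite /B /T le_eqVlt; apply/orP; left; apply/eqP.
by move: (gt_eqF nul) => /negbT hne; field.
Qed.

(** * Choice of the constants *)

Theorem theorem4p9 (R : realType) (lambda : R)
    (h1 : 1 + lambda > mu_t R ^+ 4)
    (h2 : 2 * (1 + lambda) > mu_t R ^+ 2 * (1 + Num.sqrt (1 + 4 * lambda))) :
  exists (p : {poly R}) (c' : R), 0 < c' /\
    forall n : nat,
      gibbs_event lambda (fault_sets n) <= p.[n%:R] * expR (- c' * n%:R).
Proof.
set mu := mu_t R in h1 h2.
have mu1 : 1 <= mu := mu_t_ge1 R.
have mu0 : 0 <= mu by apply: le_trans mu1.
have l0 : 0 < lambda.
  by rewrite -(ltrD2l 1) addr0; apply: le_lt_trans h1; rewrite exprn_ege1.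
pose r := (1 + Num.sqrt (1 + 4 * lambda)) / 2.
pose s := Num.sqrt (1 + lambda); pose q := Num.sqrt s.
have l1 : 0 <= 1 + 4 * lambda by rewrite addr_ge0 // mulr_ge0 // ltW.
have l2 : 0 <= 1 + lambda by rewrite addr_ge0 // ltW.
have sE : s ^+ 2 = 1 + lambda by rewrite sqr_sqrtr.
have s0 : 0 < s by rewrite sqrtr_gt0 ltr_pwDl // ltW.
have qE : q ^+ 2 = s by rewrite sqr_sqrtr // ltW.
have q4 : q ^+ 4 = 1 + lambda by rewrite (exprM q 2 2) qE sE.
have q0 : 0 <= q by apply: sqrtr_ge0.
have r1 : 1 <= r.
  rewrite /r ler_pdivlMr // mul1r lerD2l -[leLHS]sqrtr1 ler_wsqrtr // lerDl.
  by rewrite mulr_ge0 // ltW.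
have r0 : 0 < r by apply: lt_le_trans r1.
have rE : r ^+ 2 = r + lambda.
  have : (2 * r - 1) ^+ 2 = 1 + 4 * lambda by rewrite /r mulrC divfK // addrC addKr
    sqr_sqrtr.
  by move=> H; lra.
(* The hypotheses say that [mu ^+ 2] is less than [s] and than [s ^+ 2 / r]. Placing [nu ^+ 2]
   halfway between [mu ^+ 2] and [m] keeps both inequalities: the first gives [nu <= q], the second
   [th < 1]. *)
pose m := Num.min s (s ^+ 2 / r).
have mum : mu ^+ 2 < m.
  rewrite lt_min -(ltr_pXn2r (n := 2)) ?nnegrE ?exprn_ge0 ?(ltW s0) // -exprM sE h1 /=.
  rewrite ltr_pdivlMr //; move: h2; rewrite /r => h2'; lra.
pose nu := Num.sqrt ((mu ^+ 2 + m) / 2).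
have nuE : nu ^+ 2 = (mu ^+ 2 + m) / 2.
  by rewrite sqr_sqrtr // divr_ge0 // addr_ge0 ?exprn_ge0 // (le_trans _ (ltW mum))
    ?exprn_ge0.
have nu0 : 0 <= nu by apply: sqrtr_ge0.
have munu : mu < nu.
  by rewrite -(ltr_pXn2r (n := 2)) ?nnegrE // nuE; move: mum; clear; lra.
have num : nu ^+ 2 < m by rewrite nuE; move: mum; clear; lra.
have nu1 : 1 <= nu by apply: (le_trans mu1); apply: ltW.
have nuq : nu <= q.
  rewrite -(ler_pXn2r (n := 2)) ?nnegrE // qE ltW // (lt_le_trans num) //.
  by rewrite /m ge_min lexx.
have [C C0 hC] := taxi_count_bound munu.
pose th := r * nu ^+ 2 / q ^+ 4.
have th0 : 0 < th.
  by rewrite /th q4 -sE !divr_gt0 ?mulr_gt0 ?exprn_gt0 // (lt_le_trans _ nu1).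
have th1 : th < 1.
  rewrite /th q4 -sE ltr_pdivrMr ?exprn_gt0 // mul1r mulrC -ltr_pdivlMr //.
  by apply: (lt_le_trans num); rewrite /m ge_min lexx orbT.
pose K := 32 * C ^+ 2 * r * q ^+ 11 * 2 ^+ 10.
have K0 : 0 <= K by rewrite /K; do ![apply: mulr_ge0 => //]; rewrite ?exprn_ge0 // ltW.
exists (K *: 'X^10), (- ln th); split; first by rewrite oppr_gt0 ln_lt0 // th0.
move=> n; rewrite opprK hornerZ hornerXn expRM_natr lnK ?posrE //.
have -> : gibbs_event lambda (fault_sets n) =
    (\sum_(I in fault_sets n) lambda ^+ #|I|) / partition_function n lambda.
  by rewrite /gibbs_event big_distrl.
have Z0 : 0 < partition_function n lambda.
  rewrite /partition_function (bigD1 finset.set0) /=; last first.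
    by apply/independentP => u v; rewrite inE.
  rewrite cards0 expr0; apply: ltr_pwDl => //.
  by apply: sumr_ge0 => I _; apply: exprn_ge0; apply: ltW.
rewrite ler_pdivrMr //; case: n Z0 => [|k] Z0; last first.
  exact: fault_sum_bound (ltW l0) r1 rE q4 nu1 nuq C0 hC.
(* For [n = 0] the polynomial vanishes, and an empty grid has no fault line. *)
rewrite big1 => [|I]; first by rewrite expr0n /= mulr0 !mul0r.
rewrite inE => /andP[_ /asboolP[[|x t] //]] /andP[/and4P[_ _ /andP[+ _] _] _].
by case/existsP => -[[]].
Qed.
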